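(* For $k=1,2$ let $a_k\in\mathbb D$, $0\le\gamma_k<2\pi$, $a_k'=|1+a_k|-1$, $\gamma_{a_k}=\arg(1+\overline{a_k})$, and let $f_k=h_k+\overline{g_k}\in\mathcal S(H^{a_k}_{\gamma_k})$ satisfy $h_k(z)+e^{-2i(\gamma_k+\gamma_{a_k})}g_k(z)=\frac{(1+a_k')z}{1-e^{i(\gamma_k+\gamma_{a_k})}z}$. If $f_1*f_2$ is locally univalent in $\mathbb D$, then $f_1*f_2$ is univalent and convex in the direction $-\Gamma$, where $\Gamma=\gamma_1+\gamma_2+\gamma_{a_1}+\gamma_{a_2}$.
   Context: $\mathbb D$ is the open unit disk. Harmonic $f=h+\overline g$ on $\mathbb D$ ($h,g$ analytic, $g(0)=0$); $\mathcal H$: those with $h(0)=g(0)=0$, $h'(0)=1$; $\mathcal S_H$: sense-preserving ($|h'|>|g'|$) univalent members of $\mathcal H$. $H^a_\gamma=\{w:\mathrm{Re}(\frac{e^{i\gamma}}{1+a}w)>-\frac12\}$, $\mathcal S(H^a_\gamma)=\{f\in\mathcal S_H:f(\mathbb D)=H^a_\gamma\}$. Harmonic convolution: $f*F=\sum a_nA_nz^n+\sum\overline{b_nB_n}\,\overline z^n$ for $f=\sum a_nz^n+\sum\overline{b_n}\,\overline z^n$, $F=\sum A_nz^n+\sum\overline{B_n}\,\overline z^n$. A univalent map $f$ is convex in the direction $\alpha$ (modulo $\pi$) if each line parallel to the line through $0$ and $e^{i\alpha}$ meets $f(\mathbb D)$ in an interval or the empty set. *)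

(* Defs.v *)
From Stdlib Require Import Reals Lra ClassicalEpsilon Classical.
Open Scope R_scope.

Definition Cplx : Type := (R * R)%type.
Definition Re (z : Cplx) : R := fst z.
Definition Im (z : Cplx) : R := snd z.
Definition RtoC (r : R) : Cplx := (r, 0).
Definition Czero : Cplx := (0, 0).
Definition Cone : Cplx := (1, 0).
Definition Cadd (z w : Cplx) : Cplx := (Re z + Re w, Im z + Im w).
Definition Copp (z : Cplx) : Cplx := (- Re z, - Im z).
Definition Csub (z w : Cplx) : Cplx := Cadd z (Copp w).
Definition Cmul (z w : Cplx) : Cplx :=
  (Re z * Re w - Im z * Im w, Re z * Im w + Im z * Re w).
Definition Cconj (z : Cplx) : Cplx := (Re z, - Im z).
Definition Cnorm (z : Cplx) : R := sqrt (Re z ^ 2 + Im z ^ 2).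
Definition Cinv (z : Cplx) : Cplx :=
  (Re z / (Re z ^ 2 + Im z ^ 2), - Im z / (Re z ^ 2 + Im z ^ 2)).
Definition Cdiv (z w : Cplx) : Cplx := Cmul z (Cinv w).
Definition Cexpi (t : R) : Cplx := (cos t, sin t).
Fixpoint Cpow (z : Cplx) (n : nat) : Cplx :=
  match n with O => Cone | S m => Cmul z (Cpow z m) end.

Definition inD (z : Cplx) : Prop := Cnorm z < 1.

Fixpoint psum (c : nat -> Cplx) (z : Cplx) (n : nat) : Cplx :=
  match n with
  | O => Cmul (c O) (Cpow z O)
  | S m => Cadd (psum c z m) (Cmul (c n) (Cpow z n))
  end.
Definition series_converges_to (c : nat -> Cplx) (z L : Cplx) : Prop :=
  Un_cv (fun n => Re (psum c z n)) (Re L) /\ Un_cv (fun n => Im (psum c z n)) (Im L).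
Definition series_sum (c : nat -> Cplx) (z : Cplx) : Cplx :=
  match excluded_middle_informative (exists L, series_converges_to c z L) with
  | left H => proj1_sig (constructive_indefinite_description _ H)
  | right _ => Czero
  end.

Definition analytic_coeffs_on_D (c : nat -> Cplx) : Prop :=
  forall z, inD z -> exists L, series_converges_to c z L.

Definition cderiv_at (h : Cplx -> Cplx) (z d : Cplx) : Prop :=
  forall eps, 0 < eps -> exists del, 0 < del /\
    forall w, 0 < Cnorm w < del ->
      Cnorm (Csub (Cdiv (Csub (h (Cadd z w)) (h z)) w) d) < eps.

Definition harmonic_of (a b : nat -> Cplx) (z : Cplx) : Cplx :=
  Cadd (series_sum a z) (Cconj (series_sum b z)).

Definition sense_preserving (a b : nat -> Cplx) : Prop :=
  forall z, inD z -> exists dh dg,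
    cderiv_at (series_sum a) z dh /\ cderiv_at (series_sum b) z dg /\
    Cnorm dg < Cnorm dh.

Definition univalent_on_D (f : Cplx -> Cplx) : Prop :=
  forall z w, inD z -> inD w -> f z = f w -> z = w.

Definition in_SH (a b : nat -> Cplx) : Prop :=
  analytic_coeffs_on_D a /\ analytic_coeffs_on_D b /\
  a O = Czero /\ b O = Czero /\ a 1%nat = Cone /\
  sense_preserving a b /\ univalent_on_D (harmonic_of a b).

Definition halfplane (a : Cplx) (gam : R) (w : Cplx) : Prop :=
  Re (Cmul (Cdiv (Cexpi gam) (Cadd Cone a)) w) > - (1 / 2).

Definition in_image_D (f : Cplx -> Cplx) (w : Cplx) : Prop := exists z, inD z /\ f z = w.

Definition in_S_halfplane (a : Cplx) (gam : R) (ca cb : nat -> Cplx) : Prop :=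
  in_SH ca cb /\ forall w, in_image_D (harmonic_of ca cb) w <-> halfplane a gam w.

Definition harm_conv (a1 b1 a2 b2 : nat -> Cplx) : Cplx -> Cplx :=
  harmonic_of (fun n => Cmul (a1 n) (a2 n)) (fun n => Cmul (b1 n) (b2 n)).

Definition locally_univalent_on_D (f : Cplx -> Cplx) : Prop :=
  forall z, inD z -> exists r, 0 < r /\
    forall u v, inD u -> inD v -> Cnorm (Csub u z) < r -> Cnorm (Csub v z) < r ->
      f u = f v -> u = v.

Definition convex_in_direction (f : Cplx -> Cplx) (alpha : R) : Prop :=
  univalent_on_D f /\
  forall (w0 : Cplx) (t1 t2 t : R), t1 <= t -> t <= t2 ->
    in_image_D f (Cadd w0 (Cmul (RtoC t1) (Cexpi alpha))) ->
    in_image_D f (Cadd w0 (Cmul (RtoC t2) (Cexpi alpha))) ->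
    in_image_D f (Cadd w0 (Cmul (RtoC t) (Cexpi alpha))).

Definition aprime (a : Cplx) : R := Cnorm (Cadd Cone a) - 1.
(** gamma_a = arg(1 + conj a), principal argument; since |a|<1 the real part
    of 1 + conj a is positive, so the principal argument is atan(Im/Re). *)
Definition gamma_a (a : Cplx) : R :=
  atan (Im (Cadd Cone (Cconj a)) / Re (Cadd Cone (Cconj a))).

(* Main.v *)
(* Put theta_k = gamma_k + arg (1 + conj a_k), c_k = |1 + a_k|, and rotate f_k by theta_k to H_k + conj G_k, so that
   H_k + G_k = c_k z / (1 - z). As z / (1 - z) is neutral for the convolution,
     2 (H_1 * H_2 - G_1 * G_2) = c_1 (H_2 - G_2) + c_2 (H_1 - G_1),
   and |G_k'| < |H_k'| makes Re ((1 - z)^2 (H_k - G_k)') positive. In the half-plane variable w = z / (1 - z) the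
   analytic function Q = H_1 * H_2 - G_1 * G_2 therefore has Re Q' > 0: its imaginary part U, which is also that of
   F = H_1 * H_2 + conj (G_1 * G_2), increases along vertical lines. A level set of U is thus the graph of a function
   of Re w, and a minimum principle on tall rectangles shows that its domain is an interval. Along this graph Re F is
   continuous and, F being locally univalent, locally injective, hence strictly monotone; so F is univalent and its
   horizontal sections are intervals. *)
From Stdlib Require Import Reals Lra Lia ClassicalEpsilon Classical.
From Coquelicot Require Import Coquelicot.
Require Import Defs.
Open Scope R_scope.

(** * Harmonic functions increasing along vertical lines *)

(** The only way a level set U = s can break up is that its graph escapes to infinity over some x;
    as U increases upwards, U then stays on one side of s along the whole vertical line over x. If U
    is at most s there but exceeds s at points to the left and to the right, a minimum principle is
    needed on an unbounded half-strip. Monotonicity supplies what is usually a growth condition: on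
    the half-strip U is bounded below by its minimum on the bottom edge, so a small multiple of a
    quadratic with negative Laplacian is enough as a barrier. The variable w = z / (1 - z) is
    dictated by (1 - z)^2 d/dz = d/dw, which turns the positivity condition into one on an ordinary
    derivative; and dU/dy = Re dQ/dw because U is an imaginary part. Local univalence enters only as
    local injectivity along a graph, so no Jacobian has to be considered. *)

Lemma rectangle_pos_lower_bound (V : R -> R -> R) (a b c d : R) :
  (forall x y, a <= x <= b -> c <= y <= d -> continuity_2d_pt V x y /\ 0 < V x y) ->
  exists e, 0 < e /\ forall x y, a <= x <= b -> c <= y <= d -> e <= V x y.
Proof.
intros HV.
(* The same number is the radius of a neighbourhood and a lower bound of [V] on it, so the uniform
   radius given by compactness is itself the bound sought. *)
assert (Hex : forall x y, exists r : posreal, a <= x <= b -> c <= y <= d ->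
  forall u v, Rabs (u - x) < r -> Rabs (v - y) < r -> r <= V u v).
{ intros x y.
  destruct (classic ((a <= x <= b) /\ (c <= y <= d))) as [[Hx Hy]|H].
  2:{ exists (mkposreal 1 Rlt_0_1); tauto. }
  destruct (HV x y Hx Hy) as [Hc Hp].
  destruct (Hc (mkposreal (V x y / 2) ltac:(lra))) as [r Hr]; simpl in Hr.
  assert (Hm : 0 < Rmin r (V x y / 2)) by (apply Rmin_pos; [apply cond_pos | lra]).
  exists (mkposreal _ Hm); intros _ _ u v Hu Hv; simpl in *.
  specialize (Hr u v (Rlt_le_trans _ _ _ Hu (Rmin_l _ _)) (Rlt_le_trans _ _ _ Hv (Rmin_l _ _))).
  apply Rabs_def2 in Hr. pose proof (Rmin_r r (V x y / 2)). lra. }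
set (del := fun x y => proj1_sig (constructive_indefinite_description _ (Hex x y))).
assert (Hdel : forall x y, a <= x <= b -> c <= y <= d ->
  forall u v, Rabs (u - x) < del x y -> Rabs (v - y) < del x y -> del x y <= V u v).
{ intros x y; unfold del; destruct (constructive_indefinite_description _ _); simpl; auto. }
destruct (compactness_value_2d a b c d del) as [e He].
exists e; split; [apply cond_pos|]; intros x y Hx Hy.
destruct (NNPP _ (He x y Hx Hy)) as (u & v & Hu & Hv & H1 & H2 & H3).
apply Rle_trans with (1 := H3). now apply Hdel.
Qed.

(** The positive lower bound is used twice: on exp W, to see that W is bounded below, and on W minus
    its infimum, which would be positive everywhere if the infimum were not attained. *)
Lemma rectangle_min (W : R -> R -> R) (a b c d : R) :
  a <= b -> c <= d ->
  (forall x y, a <= x <= b -> c <= y <= d -> continuity_2d_pt W x y) ->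
  exists x0 y0, a <= x0 <= b /\ c <= y0 <= d /\
    forall x y, a <= x <= b -> c <= y <= d -> W x0 y0 <= W x y.
Proof.
intros Hab Hcd HW.
destruct (rectangle_pos_lower_bound (fun x y => exp (W x y)) a b c d) as (e & He & Hlow).
{ intros x y Hx Hy; split; [|apply exp_pos].
  intros eps.
  destruct (proj1 (continuity_pt_locally exp (W x y)) (derivable_continuous_pt _ _ (derivable_pt_exp _)) eps) as [r Hr].
  destruct (HW x y Hx Hy r) as [r' Hr'].
  exists r'; intros u v Hu Hv; apply Hr; apply Hr'; auto. }
set (E := fun m => exists x y, a <= x <= b /\ c <= y <= d /\ m = - W x y).
destruct (completeness E) as [m [Hm1 Hm2]].
{ exists (- ln e); intros m (x & y & Hx & Hy & ->).
  specialize (Hlow x y Hx Hy).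
  apply Ropp_le_contravar. rewrite <- (ln_exp (W x y)). now apply ln_le. }
{ exists (- W a c), a, c; repeat split; lra. }
apply NNPP; intros Hno.
assert (Hgt : forall x y, a <= x <= b -> c <= y <= d -> 0 < W x y + m).
{ intros x y Hx Hy.
  assert (- W x y <= m) by (apply Hm1; exists x, y; auto).
  destruct (Rle_lt_or_eq_dec _ _ H) as [|Heq]; [lra|].
  exfalso; apply Hno; exists x, y; split; [|split]; auto.
  intros x' y' Hx' Hy'.
  assert (- W x' y' <= m) by (apply Hm1; exists x', y'; auto). lra. }
destruct (rectangle_pos_lower_bound (fun x y => W x y + m) a b c d) as (e' & He' & Hlow').
{ intros x y Hx Hy; split; [|now apply Hgt].
  apply continuity_2d_pt_plus; [now apply HW|apply continuity_2d_pt_const]. }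
assert (m <= m - e'); [|lra].
apply Hm2; intros q (x & y & Hx & Hy & ->).
specialize (Hlow' x y Hx Hy); lra.
Qed.

Lemma second_derivative_at_min (f f1 : R -> R) (c r l : R) :
  0 < r ->
  (forall x, Rabs (x - c) < r -> is_derive f x (f1 x)) ->
  is_derive f1 c l ->
  (forall x, Rabs (x - c) < r -> f c <= f x) ->
  0 <= l.
Proof.
intros Hr Hf Hf1 Hmin.
destruct (Rle_lt_dec 0 l) as [|Hl]; [assumption|exfalso].
apply is_derive_Reals in Hf1.
destruct (Hf1 (- l) ltac:(lra)) as [d Hd].
set (h := Rmin r d / 2).
assert (Hh : 0 < h < r /\ h < d).
{ pose proof (Rmin_l r d); pose proof (Rmin_r r d).
  assert (0 < Rmin r d) by (apply Rmin_pos; [assumption|apply cond_pos]).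
  unfold h; lra. }
assert (Hq : forall x, x <> c -> Rabs (x - c) < d -> (f1 x - f1 c) / (x - c) < 0).
{ intros x Hx Hxd. specialize (Hd (x - c) (Rminus_eq_contra _ _ Hx) Hxd).
  replace (c + (x - c)) with x in Hd by ring. apply Rabs_def2 in Hd. lra. }
assert (Hs : forall x, x <> c -> f1 x - f1 c = (f1 x - f1 c) / (x - c) * (x - c)).
{ intros x Hx; field. now apply Rminus_eq_contra. }
destruct (Rle_lt_dec (f1 c) 0) as [H0|H0].
- destruct (MVT_cor2 f f1 c (c + h)) as (x & Hxe & Hx); [lra| |].
  { intros x Hx; apply is_derive_Reals, Hf. rewrite Rabs_pos_eq; lra. }
  assert (f c <= f (c + h)) by (apply Hmin; rewrite Rabs_pos_eq; lra).
  specialize (Hq x ltac:(intros E; lra) ltac:(rewrite Rabs_pos_eq; lra)).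
  specialize (Hs x ltac:(intros E; lra)).
  assert (f1 x < 0) by nra. assert (f1 x * (c + h - c) < 0) by nra. lra.
- destruct (MVT_cor2 f f1 (c - h) c) as (x & Hxe & Hx); [lra| |].
  { intros x Hx; apply is_derive_Reals, Hf. rewrite Rabs_left1; lra. }
  assert (f c <= f (c - h)) by (apply Hmin; rewrite Rabs_left; lra).
  specialize (Hq x ltac:(intros E; lra) ltac:(rewrite Rabs_left; lra)).
  specialize (Hs x ltac:(intros E; lra)).
  assert (0 < f1 x) by nra. assert (0 < f1 x * (c - (c - h))) by nra. lra.
Qed.

(** The partial derivatives are data: for U = Im Q they will be the real and imaginary parts of Q'
    and Q''. The half-plane is x > l, later with l = -1/2. *)
Record upward_harmonic (l : R) (U Ux Uy Uxx Uyy : R -> R -> R) : Prop := {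
  uh_cont : forall x y, l < x -> continuity_2d_pt U x y;
  uh_x : forall x y, l < x -> is_derive (fun t => U t y) x (Ux x y);
  uh_y : forall x y, l < x -> is_derive (fun t => U x t) y (Uy x y);
  uh_xx : forall x y, l < x -> is_derive (fun t => Ux t y) x (Uxx x y);
  uh_yy : forall x y, l < x -> is_derive (fun t => Uy x t) y (Uyy x y);
  uh_laplace : forall x y, l < x -> Uxx x y + Uyy x y = 0;
  uh_pos : forall x y, l < x -> 0 < Uy x y }.

(** Negating [U] and reversing [y] together preserves growth along vertical lines; it exchanges
    large values high up with small values low down. *)
Lemma upward_harmonic_reflect l U Ux Uy Uxx Uyy :
  upward_harmonic l U Ux Uy Uxx Uyy ->
  upward_harmonic l (fun x y => - U x (- y)) (fun x y => - Ux x (- y))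
    (fun x y => Uy x (- y)) (fun x y => - Uxx x (- y)) (fun x y => - Uyy x (- y)).
Proof.
intros [H0 H1 H2 H3 H4 H5 H6]; split; intros x y Hx.
- intros eps. destruct (H0 x (- y) Hx eps) as [r Hr]. exists r; intros u v Hu Hv.
  replace (- U u (- v) - - U x (- y)) with (- (U u (- v) - U x (- y))) by ring.
  rewrite Rabs_Ropp. apply Hr; [assumption|].
  replace (- v - - y) with (- (v - y)) by ring. now rewrite Rabs_Ropp.
- apply (is_derive_opp (fun t => U t (- y))); now apply H1.
- replace (Uy x (- y)) with (- (-1 * Uy x (- y))) by ring.
  apply (is_derive_opp (fun t => U x (- t))). apply (is_derive_comp (fun t => U x t) Ropp); [now apply H2|].
  auto_derive; [trivial|ring].
- apply (is_derive_opp (fun t => Ux t (- y))); now apply H3.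
- replace (- Uyy x (- y)) with (-1 * Uyy x (- y)) by ring.
  apply (is_derive_comp (fun t => Uy x t) Ropp); [now apply H4|].
  auto_derive; [trivial|ring].
- pose proof (H5 x (- y) Hx); lra.
- now apply H6.
Qed.

Lemma upward_harmonic_increasing l U Ux Uy Uxx Uyy :
  upward_harmonic l U Ux Uy Uxx Uyy ->
  forall x y y', l < x -> y < y' -> U x y < U x y'.
Proof.
intros H x y y' Hx Hy.
destruct (MVT_cor2 (fun t => U x t) (fun t => Uy x t) y y' Hy) as (z & Hz & _).
{ intros z _; apply is_derive_Reals, (uh_y _ _ _ _ _ _ H); assumption. }
pose proof (uh_pos _ _ _ _ _ _ H x z Hx). nra.
Qed.

(** Suppose U is at most s on the whole line over [x0]. Above the height [y0], U is at least s + e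
    on both vertical sides and at least [C], its minimum on the bottom edge, in between. On a tall
    rectangle the barrier lifts the horizontal sides to s + e while staying below e at the centre
    over [x0], so the minimum is interior, against the sign of the Laplacian. *)
Lemma upward_harmonic_above l U Ux Uy Uxx Uyy :
  upward_harmonic l U Ux Uy Uxx Uyy ->
  forall x1 y1 x2 y2 x s, l < x1 -> x1 < x < x2 -> s < U x1 y1 -> s < U x2 y2 ->
  exists y, s < U x y.
Proof.
intros H x1 y1 x2 y2 x0 s Hl Hx Hs1 Hs2.
apply NNPP; intros Hno.
assert (Hle : forall y, U x0 y <= s).
{ intros y; apply Rnot_lt_le; intros Hy; apply Hno; now exists y. }
clear Hno.
pose proof (upward_harmonic_increasing _ _ _ _ _ _ H) as Hinc.
assert (Hincle : forall x y y', l < x -> y <= y' -> U x y <= U x y').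
{ intros x y y' Hx' [Hy| ->]; [left; now apply Hinc|lra]. }
set (y0 := Rmax y1 y2).
set (e := Rmin (U x1 y1) (U x2 y2) - s).
assert (He : 0 < e /\ s + e <= U x1 y1 /\ s + e <= U x2 y2).
{ unfold e. pose proof (Rmin_l (U x1 y1) (U x2 y2)).
  pose proof (Rmin_r (U x1 y1) (U x2 y2)).
  pose proof (Rmin_glb_lt _ _ _ Hs1 Hs2). lra. }
destruct (rectangle_min U x1 x2 y0 y0) as (xm & ym & Hxm & Hym & Hm).
{ lra. } { lra. }
{ intros x y Hx' Hy; apply (uh_cont _ _ _ _ _ _ H); lra. }
set (C := U xm ym) in Hm.
(* [K] is the amount by which the a priori bound [C] may fall short of s + e; the maximum with 1
   keeps it positive. *)
set (K := Rmax 1 (s + e - C)).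
assert (HK : 1 <= K /\ s + e - C <= K) by (split; [apply Rmax_l|apply Rmax_r]).
set (B := (x0 - x1) * (x2 - x0)).
assert (HB : 0 < B) by (apply Rmult_lt_0_compat; lra).
(* T^2 must exceed 2 K B / e. *)
set (T := 1 + 2 * K * B / e).
assert (HKB : 0 < 2 * K * B / e).
{ apply Rdiv_lt_0_compat; [|lra]. apply Rmult_lt_0_compat; lra. }
assert (HT1 : 1 < T) by (unfold T; lra).
assert (HT2 : 2 * K * B < e * T ^ 2).
{ assert (2 * K * B = e * (T - 1)) by (unfold T; field; lra).
  assert (T - 1 < T ^ 2) by nra. nra. }
set (k := K / T ^ 2).
assert (Hk : k * T ^ 2 = K) by (unfold k; field; lra).
assert (Hk0 : 0 < k) by (unfold k; apply Rdiv_lt_0_compat; nra).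
set (yc := y0 + T).
(* A strictly superharmonic barrier: Laplacian 2 - 4 < 0, at least T^2 on the horizontal sides, and fixed size at the centre. *)
set (W := fun x y => U x y + k * ((y - yc) ^ 2 + 2 * ((x - x1) * (x2 - x)))).
destruct (rectangle_min W x1 x2 y0 (y0 + 2 * T)) as (xw & yw & Hxw & Hyw & Hw).
{ lra. } { lra. }
{ intros x y Hx' Hy. apply continuity_2d_pt_plus.
  { apply (uh_cont _ _ _ _ _ _ H); lra. }
  apply continuity_2d_pt_mult; [apply continuity_2d_pt_const|].
  apply continuity_2d_pt_plus.
  - simpl. repeat apply continuity_2d_pt_mult;
      try apply continuity_2d_pt_const; apply continuity_2d_pt_minus;
      try apply continuity_2d_pt_const; apply continuity_2d_pt_id2.
  - apply continuity_2d_pt_mult; [apply continuity_2d_pt_const|].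
    apply continuity_2d_pt_mult; apply continuity_2d_pt_minus;
      try apply continuity_2d_pt_const; apply continuity_2d_pt_id1. }
assert (Hc : W xw yw < s + e).
{ apply Rle_lt_trans with (W x0 yc); [apply Hw; unfold yc; lra|].
  unfold W. fold B. pose proof (Hle yc).
  replace ((yc - yc) ^ 2) with 0 by ring. fold B.
  assert (k * (2 * B) < e); [|lra].
  apply Rmult_lt_reg_r with (T ^ 2); [nra|].
  replace (k * (2 * B) * T ^ 2) with (k * T ^ 2 * 2 * B) by ring. rewrite Hk. lra. }
assert (HUC : C <= U xw yw).
{ apply Rle_trans with (U xw y0); [apply Hm; lra|apply Hincle; lra]. }
assert (Hq : 0 <= (xw - x1) * (x2 - xw)) by (apply Rmult_le_pos; lra).
pose proof (pow2_ge_0 (yw - yc)) as Hsq.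
assert (Hx1 : xw <> x1).
{ intros ->. assert (U x1 y1 <= U x1 yw) by (apply Hincle; [|pose proof (Rmax_l y1 y2)]; unfold y0 in *; lra).
  unfold W in Hc. nra. }
assert (Hx2 : xw <> x2).
{ intros ->. assert (U x2 y2 <= U x2 yw) by (apply Hincle; [|pose proof (Rmax_r y1 y2)]; unfold y0 in *; lra).
  unfold W in Hc. nra. }
assert (Hy : (yw - yc) ^ 2 <> T ^ 2).
{ intros E. unfold W in Hc. rewrite E in Hc. nra. }
assert (Hy1 : yw <> y0) by (intros E; apply Hy; unfold yc; rewrite E; ring).
assert (Hy2 : yw <> y0 + 2 * T) by (intros E; apply Hy; unfold yc; rewrite E; ring).
set (r1 := Rmin (xw - x1) (x2 - xw)).
set (r2 := Rmin (yw - y0) (y0 + 2 * T - yw)).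
assert (Hr1 : 0 < r1) by (apply Rmin_pos; lra).
assert (Hr2 : 0 < r2) by (apply Rmin_pos; lra).
assert (Hb1 : forall t, Rabs (t - xw) < r1 -> x1 <= t <= x2).
{ intros t Ht. apply Rabs_def2 in Ht. unfold r1 in Ht.
  pose proof (Rmin_l (xw - x1) (x2 - xw)). pose proof (Rmin_r (xw - x1) (x2 - xw)). lra. }
assert (Hb2 : forall t, Rabs (t - yw) < r2 -> y0 <= t <= y0 + 2 * T).
{ intros t Ht. apply Rabs_def2 in Ht. unfold r2 in Ht.
  pose proof (Rmin_l (yw - y0) (y0 + 2 * T - yw)). pose proof (Rmin_r (yw - y0) (y0 + 2 * T - yw)). lra. }
assert (Hxx : 0 <= Uxx xw yw + k * (-4)).
{ apply (second_derivative_at_min (fun t => W t yw)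
    (fun t => Ux t yw + k * (2 * (x1 + x2 - 2 * t))) xw r1); [assumption| | |].
  - intros t Ht. apply (is_derive_plus (fun t => U t yw)).
    + apply (uh_x _ _ _ _ _ _ H). specialize (Hb1 t Ht); lra.
    + auto_derive; [trivial|ring].
  - apply (is_derive_plus (fun t => Ux t yw)).
    + apply (uh_xx _ _ _ _ _ _ H); lra.
    + auto_derive; [trivial|ring].
  - intros t Ht; apply Hw; [now apply Hb1|lra]. }
assert (Hyy : 0 <= Uyy xw yw + k * 2).
{ apply (second_derivative_at_min (fun t => W xw t)
    (fun t => Uy xw t + k * (2 * (t - yc))) yw r2); [assumption| | |].
  - intros t Ht. apply (is_derive_plus (fun t => U xw t)).
    + apply (uh_y _ _ _ _ _ _ H); lra.
    + auto_derive; [trivial|ring].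
  - apply (is_derive_plus (fun t => Uy xw t)).
    + apply (uh_yy _ _ _ _ _ _ H); lra.
    + auto_derive; [trivial|ring].
  - intros t Ht; apply Hw; [lra|now apply Hb2]. }
pose proof (uh_laplace _ _ _ _ _ _ H xw yw ltac:(lra)). lra.
Qed.

(** Over [x] there is a value above s by [upward_harmonic_above] and one below s by its reflection.
    The given points are moved up or down by 1 since strict inequalities are required there. *)
Lemma upward_harmonic_level l U Ux Uy Uxx Uyy :
  upward_harmonic l U Ux Uy Uxx Uyy ->
  forall x1 y1 x2 y2 x s, l < x1 -> x1 <= x <= x2 -> U x1 y1 = s -> U x2 y2 = s ->
  exists y, U x y = s.
Proof.
intros H x1 y1 x2 y2 x s Hl Hx H1 H2.
destruct (Req_dec x x1) as [->|]; [now exists y1|].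
destruct (Req_dec x x2) as [->|]; [now exists y2|].
pose proof (upward_harmonic_increasing _ _ _ _ _ _ H) as Hinc.
destruct (upward_harmonic_above _ _ _ _ _ _ H x1 (y1 + 1) x2 (y2 + 1) x s) as [yu Hu];
  [lra|lra|rewrite <- H1; apply Hinc; lra|rewrite <- H2; apply Hinc; lra|].
destruct (upward_harmonic_above _ _ _ _ _ _ (upward_harmonic_reflect _ _ _ _ _ _ H)
  x1 (- (y1 - 1)) x2 (- (y2 - 1)) x (- s)) as [yd Hd]; try lra.
{ rewrite Ropp_involutive. apply Ropp_lt_contravar. rewrite <- H1; apply Hinc; lra. }
{ rewrite Ropp_involutive. apply Ropp_lt_contravar. rewrite <- H2; apply Hinc; lra. }
destruct (IVT_gen (fun t => U x t) (- yd) yu s) as (y & _ & Hy); [| |now exists y].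
- intros y. apply derivable_continuous_pt. exists (Uy x y).
  apply is_derive_Reals, (uh_y _ _ _ _ _ _ H); lra.
- rewrite Rmin_left, Rmax_right; lra.
Qed.

(** * Locally injective continuous functions on an interval *)

Lemma locally_injective_no_interior_max (f : R -> R) (a b c : R) :
  a < c < b -> continuity f ->
  (exists r, 0 < r /\ forall u v, a <= u <= b -> a <= v <= b ->
     Rabs (u - c) < r -> Rabs (v - c) < r -> f u = f v -> u = v) ->
  exists x, a <= x <= b /\ f c < f x.
Proof.
intros Hc Hcont (r & Hr & Hinj).
apply NNPP; intros Hno.
assert (Hmax : forall x, a <= x <= b -> f x <= f c).
{ intros x Hx; apply Rnot_lt_le; intros H; apply Hno; now exists x. }
set (h := Rmin r (Rmin (c - a) (b - c)) / 2).
assert (Hh : 0 < h /\ h < r /\ a <= c - h /\ c + h <= b).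
{ pose proof (Rmin_l r (Rmin (c - a) (b - c))). pose proof (Rmin_r r (Rmin (c - a) (b - c))).
  pose proof (Rmin_l (c - a) (b - c)). pose proof (Rmin_r (c - a) (b - c)).
  assert (0 < Rmin r (Rmin (c - a) (b - c))) by (repeat apply Rmin_pos; lra).
  unfold h; lra. }
assert (Hnear : forall x, c - h <= x <= c + h -> Rabs (x - c) < r).
{ intros x Hx. apply Rabs_def1; lra. }
assert (Hlt : forall x, x <> c -> c - h <= x <= c + h -> f x < f c).
{ intros x Hxc Hx.
  destruct (Hmax x ltac:(lra)) as [|E]; [assumption|].
  exfalso; apply Hxc, Hinj; try lra; apply Hnear; lra. }
assert (HA : f (c - h) < f c) by (apply Hlt; [intros E; lra|lra]).
assert (HB : f (c + h) < f c) by (apply Hlt; [intros E; lra|lra]).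
(* The value [v] lies below [f c] but not below either outer value, so it is taken on both sides of
   [c], against local injectivity. *)
set (v := Rmax (f (c - h)) (f (c + h))).
assert (Hv : f (c - h) <= v /\ f (c + h) <= v /\ v < f c).
{ split; [apply Rmax_l|split; [apply Rmax_r|now apply Rmax_lub_lt]]. }
destruct (IVT_gen f (c - h) c v Hcont) as (x & Hx & Ex).
{ rewrite Rmin_left, Rmax_right; lra. }
destruct (IVT_gen f c (c + h) v Hcont) as (y & Hy & Ey).
{ rewrite Rmin_right, Rmax_left; lra. }
rewrite Rmin_left, Rmax_right in Hx, Hy by lra.
assert (x = y).
{ apply Hinj; try lra; apply Hnear; lra. }
assert (Exc : x = c) by lra. rewrite Exc in Ex. lra.
Qed.

(** Were the end values equal, the maximum and the minimum over the interval, which cannot be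
    interior, would both equal them; [f] would be constant there, contradicting local injectivity at
    [a]. *)
Lemma locally_injective_injective (f : R -> R) (a b : R) :
  a < b -> continuity f ->
  (forall x, a <= x <= b -> exists r, 0 < r /\ forall u v, a <= u <= b -> a <= v <= b ->
     Rabs (u - x) < r -> Rabs (v - x) < r -> f u = f v -> u = v) ->
  f a <> f b.
Proof.
intros Hab Hc Hinj E.
destruct (continuity_ab_maj f a b) as (M & HM & HMab); [lra|auto|].
destruct (continuity_ab_min f a b) as (m & Hm & Hmab); [lra|auto|].
assert (HMe : f M = f a).
{ destruct (Req_dec M a) as [->|]; [reflexivity|]. destruct (Req_dec M b) as [->|]; [easy|].
  destruct (locally_injective_no_interior_max f a b M) as (x & Hx & Hx'); auto; [lra|].
  specialize (HM x Hx). lra. }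
assert (Hme : f m = f a).
{ destruct (Req_dec m a) as [->|]; [reflexivity|]. destruct (Req_dec m b) as [->|]; [easy|].
  destruct (locally_injective_no_interior_max (fun x => - f x) a b m) as (x & Hx & Hx').
  - lra.
  - now apply continuity_opp.
  - destruct (Hinj m Hmab) as (r & Hr & Hr'). exists r; split; [assumption|].
    intros u v Hu Hv Hu' Hv' E'. apply Hr'; auto; lra.
  - specialize (Hm x Hx). lra. }
destruct (Hinj a) as (r & Hr & Hr'); [lra|].
set (h := Rmin r (b - a) / 2).
assert (Hh : 0 < h /\ h < r /\ a + h <= b).
{ pose proof (Rmin_l r (b - a)). pose proof (Rmin_r r (b - a)).
  assert (0 < Rmin r (b - a)) by (apply Rmin_pos; lra). unfold h; lra. }
assert (a = a + h); [|lra].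
apply Hr'; try lra; [apply Rabs_def1; lra|apply Rabs_def1; lra|].
specialize (HM (a + h) ltac:(lra)). specialize (Hm (a + h) ltac:(lra)). lra.
Qed.

(** * Level sets as graphs over intervals *)

Lemma upward_harmonic_graph l U Ux Uy Uxx Uyy :
  upward_harmonic l U Ux Uy Uxx Uyy ->
  forall x1 x2 s (Y : R -> R), l < x1 -> (forall x, x1 <= x <= x2 -> U x (Y x) = s) ->
  forall x e, x1 <= x <= x2 -> 0 < e ->
  exists d, 0 < d /\ forall x', x1 <= x' <= x2 -> Rabs (x' - x) < d -> Rabs (Y x' - Y x) < e.
Proof.
intros H x1 x2 s Y Hl HY x e Hx He.
pose proof (upward_harmonic_increasing _ _ _ _ _ _ H) as Hinc.
(* The inequalities U < s below the graph and U > s above it persist for nearby x', and monotonicity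
   then traps Y x' between the two heights. *)
assert (Hd : U x (Y x - e) < s) by (rewrite <- (HY x Hx); apply Hinc; lra).
assert (Hu : s < U x (Y x + e)) by (rewrite <- (HY x Hx); apply Hinc; lra).
destruct (uh_cont _ _ _ _ _ _ H x (Y x - e) ltac:(lra) (mkposreal (s - U x (Y x - e)) ltac:(lra))) as [d1 Hd1].
destruct (uh_cont _ _ _ _ _ _ H x (Y x + e) ltac:(lra) (mkposreal (U x (Y x + e) - s) ltac:(lra))) as [d2 Hd2].
simpl in *.
exists (Rmin d1 d2); split; [apply Rmin_pos; apply cond_pos|].
intros x' Hx' Hn.
specialize (Hd1 x' (Y x - e) (Rlt_le_trans _ _ _ Hn (Rmin_l _ _))).
specialize (Hd2 x' (Y x + e) (Rlt_le_trans _ _ _ Hn (Rmin_r _ _))).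
rewrite Rminus_diag, Rabs_R0 in Hd1, Hd2.
specialize (Hd1 (cond_pos d1)). specialize (Hd2 (cond_pos d2)).
apply Rabs_def2 in Hd1. apply Rabs_def2 in Hd2.
pose proof (HY x' Hx') as E.
apply Rabs_def1; apply Rnot_le_lt; intros Hc.
- destruct Hc as [Hc|Hc].
  + pose proof (Hinc x' (Y x + e) (Y x') ltac:(lra) ltac:(lra)). lra.
  + replace (Y x + e) with (Y x') in Hd2 by lra. lra.
- destruct Hc as [Hc|Hc].
  + pose proof (Hinc x' (Y x') (Y x - e) ltac:(lra) ltac:(lra)). lra.
  + replace (Y x - e) with (Y x') in Hd1 by lra. lra.
Qed.

(* On each level set of [U], a graph over an interval, [V] is continuous and locally injective, hence strictly monotone. *)
Lemma halfplane_shear l U Ux Uy Uxx Uyy (V : R -> R -> R) :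
  upward_harmonic l U Ux Uy Uxx Uyy ->
  (forall x y, l < x -> continuity_2d_pt V x y) ->
  (forall x y, l < x -> exists r, 0 < r /\ forall u v u' v', l < u -> l < u' ->
     Rabs (u - x) < r -> Rabs (v - y) < r -> Rabs (u' - x) < r -> Rabs (v' - y) < r ->
     U u v = U u' v' -> V u v = V u' v' -> u = u' /\ v = v') ->
  forall x1 y1 x2 y2, l < x1 -> x1 <= x2 -> U x1 y1 = U x2 y2 ->
  (V x1 y1 = V x2 y2 -> x1 = x2 /\ y1 = y2) /\
  (forall t, Rmin (V x1 y1) (V x2 y2) <= t <= Rmax (V x1 y1) (V x2 y2) ->
     exists x y, l < x /\ U x y = U x1 y1 /\ V x y = t).
Proof.
intros H HV Hinj x1 y1 x2 y2 Hl [Hx| ->] E.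
2:{ pose proof (upward_harmonic_increasing _ _ _ _ _ _ H) as Hinc.
  assert (y1 = y2).
  { destruct (Rtotal_order y1 y2) as [Hy|[Hy|Hy]]; [|assumption|];
    pose proof (Hinc x2 _ _ Hl Hy); lra. }
  subst y2; split; [tauto|]. intros t Ht. exists x2, y1; repeat split; auto.
  rewrite Rmin_left, Rmax_right in Ht by lra. lra. }
pose proof (upward_harmonic_increasing _ _ _ _ _ _ H) as Hinc.
set (s := U x1 y1) in *.
assert (Hex : forall x, exists y, x1 <= x <= x2 -> U x y = s).
{ intros x. destruct (classic (x1 <= x <= x2)) as [Hx'|]; [|exists 0; tauto].
  destruct (upward_harmonic_level _ _ _ _ _ _ H x1 y1 x2 y2 x s) as [y Hy]; auto. now exists y. }
set (Y := fun x => proj1_sig (constructive_indefinite_description _ (Hex x))).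
assert (HY : forall x, x1 <= x <= x2 -> U x (Y x) = s).
{ intros x; unfold Y; now destruct constructive_indefinite_description. }
assert (Huniq : forall x y y', l < x -> U x y = U x y' -> y = y').
{ intros x y y' Hx' E'. destruct (Rtotal_order y y') as [Hy|[Hy|Hy]]; [|assumption|];
    pose proof (Hinc x _ _ Hx' Hy); lra. }
assert (HY1 : Y x1 = y1) by (apply (Huniq x1); [lra|]; rewrite HY; [reflexivity|lra]).
assert (HY2 : Y x2 = y2) by (apply (Huniq x2); [lra|]; rewrite HY; [exact E|lra]).
pose proof (upward_harmonic_graph _ _ _ _ _ _ H x1 x2 s Y Hl HY) as HYc.
(* Clamping to [x1, x2], a 1-Lipschitz map, extends the function along the graph to a continuous
   function on the whole line, as the intermediate value theorem in use demands. *)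
set (cl := fun x => Rmax x1 (Rmin x2 x)).
assert (Hcl : forall x, x1 <= cl x <= x2).
{ intros x; unfold cl. split; [apply Rmax_l|apply Rmax_lub; [lra|apply Rmin_l]]. }
assert (Hid : forall x, x1 <= x <= x2 -> cl x = x).
{ intros x Hx'; unfold cl. rewrite Rmin_right by lra. apply Rmax_right; lra. }
assert (Hlip : forall x x', Rabs (cl x' - cl x) <= Rabs (x' - x)).
{ intros x x'. unfold cl, Rmax, Rmin.
  repeat destruct Rle_dec; unfold Rabs; repeat destruct Rcase_abs; lra. }
set (f := fun x => V (cl x) (Y (cl x))).
assert (Hf : continuity f).
{ intros x e He.
  destruct (HV (cl x) (Y (cl x)) ltac:(specialize (Hcl x); lra) (mkposreal e He)) as [d Hd].
  destruct (HYc (cl x) d (Hcl x) (cond_pos d)) as (d' & Hd' & Hd'').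
  exists (Rmin d d'); split; [apply Rmin_pos; [apply cond_pos|assumption]|].
  intros x' [_ Hx']. simpl in *. unfold Rdist in *.
  pose proof (Hlip x x'). pose proof (Rmin_l d d'). pose proof (Rmin_r d d').
  apply Hd; [lra|]. apply Hd''; [apply Hcl|lra]. }
assert (Hf1 : f x1 = V x1 y1) by (unfold f; rewrite Hid, HY1; lra).
assert (Hf2 : f x2 = V x2 y2) by (unfold f; rewrite Hid, HY2; lra).
split.
- intros EV; exfalso; revert EV. rewrite <- Hf1, <- Hf2.
  apply locally_injective_injective; [assumption|assumption|].
  intros x Hx'. destruct (Hinj x (Y x) ltac:(lra)) as (r & Hr & Hr').
  destruct (HYc x r Hx' Hr) as (d & Hd & Hd').
  exists (Rmin r d); split; [now apply Rmin_pos|].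
  intros u v Hu Hv Hu' Hv' EV. unfold f in EV. rewrite !Hid in EV by assumption.
  pose proof (Rmin_l r d). pose proof (Rmin_r r d).
  apply (Hr' u (Y u) v (Y v)); try lra; try (apply Hd'; lra).
  now rewrite !HY.
- intros t Ht. rewrite <- Hf1, <- Hf2 in Ht.
  destruct (IVT_gen f x1 x2 t Hf Ht) as (x & _ & Ex).
  exists (cl x), (Y (cl x)). repeat split; [specialize (Hcl x); lra|now apply HY|assumption].
Qed.

Open Scope C_scope.

(** * Complex power series *)

(** Here C is a normed module over itself, which makes the generic rules for products and
    compositions applicable. *)
Definition is_cderive (f : C -> C) (z d : C) : Prop :=
  @is_derive C_AbsRing (AbsRing_NormedModule C_AbsRing) f z d.
(* [Defs.Cplx] is convertible to [C], but [ring] finds its structure from the syntactic type of the left-hand side. *)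
Ltac cring := apply Ceq_minus; ring.
Ltac cfield := apply Ceq_minus; field.

Notation is_cseries := (@is_series C_AbsRing C_NormedModule).

Lemma is_cderive_iff (f : C -> C) (z d : C) :
  is_cderive f z d <->
  forall e : R, (0 < e)%R -> exists r : R, (0 < r)%R /\ forall u, (Cmod (u - z) < r)%R ->
    (Cmod (f u - f z - d * (u - z)) <= e * Cmod (u - z))%R.
Proof.
split.
- intros [_ H] e He.
  destruct (H z (fun P HP => HP) (mkposreal e He)) as [r Hr].
  exists r; split; [apply cond_pos|]. intros u Hu. specialize (Hr u Hu).
  replace (d * (u - z)) with ((u - z) * d) by ring. exact Hr.
- intros H; split; [apply @is_linear_scal_l|].
  intros x Hx. rewrite <- (@is_filter_lim_locally_unique C_AbsRing (AbsRing_NormedModule C_AbsRing) _ _ Hx).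
  intros e. destruct (H e (cond_pos e)) as (r & Hr & Hr').
  exists (mkposreal r Hr). intros u Hu. specialize (Hr' u Hu).
  replace (d * (u - z)) with ((u - z) * d) in Hr' by ring. exact Hr'.
Qed.

Lemma is_cderive_unique (f : C -> C) (z d d' : C) :
  is_cderive f z d -> is_cderive f z d' -> d = d'.
Proof.
intros H H'. apply Ceq_minus, NNPP; intros Hd. apply Cmod_gt_0 in Hd.
rewrite is_cderive_iff in H, H'.
destruct (H (Cmod (d - d') / 3)%R) as (r & Hr & H1); [lra|].
destruct (H' (Cmod (d - d') / 3)%R) as (r' & Hr' & H2); [lra|].
set (t := (Rmin r r' / 2)%R).
assert (Ht : (0 < t < r /\ t < r')%R).
{ pose proof (Rmin_l r r'). pose proof (Rmin_r r r'). pose proof (Rmin_pos _ _ Hr Hr').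
  unfold t; lra. }
assert (Ezt : z + t - z = t) by ring.
assert (Et : Cmod t = t) by (rewrite Cmod_R; apply Rabs_pos_eq; lra).
specialize (H1 (z + t)). specialize (H2 (z + t)). rewrite !Ezt, Et in H1, H2.
specialize (H1 ltac:(lra)). specialize (H2 ltac:(lra)).
pose proof (Cmod_triangle (f (z + t) - f z - d' * t) (- (f (z + t) - f z - d * t))) as HT.
replace (f (z + t) - f z - d' * t + - (f (z + t) - f z - d * t)) with ((d - d') * t) in HT by ring.
rewrite Cmod_opp, Cmod_mult, Et in HT. nra.
Qed.

Lemma Cmod_pow (z : C) n : Cmod (z ^ n) = (Cmod z ^ n)%R.
Proof.
induction n as [|n IH]; simpl; [apply Cmod_1|]. now rewrite Cmod_mult, IH.
Qed.

Lemma is_series_converges c z L :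
  series_converges_to c z L <-> is_cseries (fun n => c n * z ^ n) L.
Proof.
assert (Hp : forall n, psum c z n = @sum_n C_AbelianMonoid (fun n => c n * z ^ n) n).
{ induction n as [|n IH].
  - rewrite sum_O. reflexivity.
  - rewrite sum_Sn, <- IH. reflexivity. }
unfold series_converges_to, is_series. split.
- intros [H1 H2]. apply is_lim_seq_Reals in H1, H2.
  intros P [e He].
  destruct (H1 _ (locally_ball (Re L) e)) as [N1 HN1].
  destruct (H2 _ (locally_ball (Im L) e)) as [N2 HN2].
  exists (N1 + N2)%nat; intros n Hn. apply He. rewrite <- Hp.
  split; [apply HN1|apply HN2]; lia.
- intros H; split; apply is_lim_seq_Reals; intros P [e He];
  destruct (H _ (@locally_ball C_UniformSpace L e)) as [N HN];
  exists N; intros n Hn; apply He; rewrite Hp; apply HN, Hn.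
Qed.

Lemma is_series_unique_C (u : nat -> C) (L L' : C) : is_cseries u L -> is_cseries u L' -> L = L'.
Proof. intros H H'. exact (@filterlim_locally_unique _ C_AbsRing C_NormedModule eventually _ _ _ _ H H'). Qed.

Lemma series_sum_unique c z L : is_cseries (fun n => c n * z ^ n) L -> series_sum c z = L.
Proof.
intros H. unfold series_sum. destruct excluded_middle_informative as [E|E].
- apply (is_series_unique_C _ _ _ (proj1 (is_series_converges _ _ _)
    (proj2_sig (constructive_indefinite_description _ E))) H).
- exfalso; apply E. exists L. now apply is_series_converges.
Qed.

Lemma series_sum_correct c z : analytic_coeffs_on_D c -> (Cmod z < 1)%R ->
  is_cseries (fun n => c n * z ^ n) (series_sum c z).
Proof.
intros Hc Hz. destruct (Hc z Hz) as [L HL]. apply is_series_converges in HL.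
now rewrite (series_sum_unique _ _ _ HL).
Qed.

Lemma is_cseries_abs (u : nat -> C) (v : nat -> R) :
  (forall n, Cmod (u n) <= v n)%R -> ex_series v -> exists L, is_cseries u L.
Proof.
intros H Hv. 
destruct (@ex_series_le C_AbsRing C_CompleteNormedModule u v) as [L HL]; [exact H|exact Hv|].
now exists L.
Qed.

Lemma is_cseries_Cmod_le (u : nat -> C) (v : nat -> R) (L : C) (l : R) :
  (forall n, Cmod (u n) <= v n)%R -> is_cseries u L -> is_series v l -> (Cmod L <= l)%R.
Proof.
intros H HL Hl.
assert (HN : is_lim_seq (fun n => Cmod (sum_n u n)) (Cmod L)).
{ apply (filterlim_comp _ _ _ _ _ _ _ _ HL (@filterlim_norm C_AbsRing C_NormedModule L)). }
apply (is_lim_seq_le (fun n => Cmod (sum_n u n)) (sum_n v) (Cmod L) l); [|assumption|exact Hl].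
intros n. apply Rle_trans with (sum_n (fun n => Cmod (u n)) n).
- apply (@norm_sum_n_m C_AbsRing C_NormedModule).
- now apply sum_n_m_le.
Qed.

Lemma minus_plus_l {G : AbelianGroup} (x y : G) : minus (plus x y) x = y.
Proof.
unfold minus. rewrite (plus_comm x y), <- plus_assoc.
transitivity (plus y zero); [apply f_equal, plus_opp_r|apply plus_zero_r].
Qed.

Lemma ex_series_bounded {K : AbsRing} {V : NormedModule K} (a : nat -> V) :
  ex_series a -> exists M : R, forall n, (norm (a n) <= M)%R.
Proof.
intros [l Hl].
destruct (filterlim_bounded (sum_n a) (ex_intro _ l Hl)) as [M HM].
exists (M + M)%R; intros [|n].
- specialize (HM 0%nat). rewrite sum_O in HM. pose proof (norm_ge_0 (a 0%nat)). lra.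
- replace (a (S n)) with (minus (sum_n a (S n)) (sum_n a n)).
  + eapply Rle_trans; [apply norm_triangle|]. rewrite norm_opp.
    apply Rplus_le_compat; apply HM.
  + rewrite sum_Sn. apply (@minus_plus_l (NormedModule.AbelianGroup K V)).
Qed.

(* Radius of convergence at least 1, in the form of Abel's bound. *)
Definition abel_bounded (c : nat -> C) : Prop :=
  forall p : R, (0 < p < 1)%R -> exists M : R, forall n, (Cmod (c n) * p ^ n <= M)%R.

Lemma analytic_abel_bounded c : analytic_coeffs_on_D c -> abel_bounded c.
Proof.
intros Hc p Hp.
assert (Ep : Cmod p = p) by (rewrite Cmod_R; apply Rabs_pos_eq; lra).
destruct (@ex_series_bounded C_AbsRing C_NormedModule (fun n => c n * (p : C) ^ n)) as [M HM].
{ exists (series_sum c (p : C)). apply series_sum_correct; [assumption|]. rewrite Ep; lra. }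
exists M; intros n. specialize (HM n).
change (norm (c n * (p : C) ^ n)) with (Cmod (c n * (p : C) ^ n)) in HM.
now rewrite Cmod_mult, Cmod_pow, Ep in HM.
Qed.

(** The n + 1 copies of p^n are dominated by 1 + p + ... + p^n = (1 - p^(n+1)) / (1 - p). *)
Lemma INR_pow_bounded (p : R) : (0 < p < 1)%R -> forall n, (INR (S n) * p ^ n <= / (1 - p))%R.
Proof.
intros Hp n.
apply Rmult_le_reg_r with (1 - p)%R; [lra|]. rewrite Rinv_l by lra.
assert (H : (INR (S n) * p ^ n * (1 - p) <= 1 - p ^ S n)%R).
{ induction n as [|n IH]; [simpl; lra|].
  rewrite (S_INR (S n)). simpl pow in *.
  pose proof (pow_lt p n ltac:(lra)).
  assert (0 <= INR (S n))%R by apply pos_INR.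
  replace ((INR (S n) + 1) * (p * p ^ n) * (1 - p))%R
    with (p * (INR (S n) * p ^ n * (1 - p)) + p * p ^ n * (1 - p))%R by ring.
  assert (0 <= INR (S n) * p ^ n * (1 - p))%R by (repeat apply Rmult_le_pos; lra).
  apply Rle_trans with (p * (1 - p * p ^ n) + p * p ^ n * (1 - p))%R.
  - apply Rplus_le_compat_r, Rmult_le_compat_l; lra.
  - nra. }
pose proof (pow_lt p (S n) ltac:(lra)). lra.
Qed.

(** The weight (n + 1)^2 is the one that appears in the second-order remainder of z^n; it also
    covers the plain series and its derivative. *)
Lemma abel_bounded_summable c (r : R) : abel_bounded c -> (0 <= r < 1)%R ->
  ex_series (fun n => Cmod (c n) * (INR (S n) ^ 2 * r ^ n))%R.
Proof.
intros Hc Hr.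
(* Close enough to 1 for r <= p^4: one factor p^n absorbs [c n], two absorb the weight, and the last
   leaves a convergent geometric series. *)
set (p := (1 - (1 - r) / 8)%R).
assert (Hp : (0 < p < 1)%R) by (unfold p; lra).
assert (Hrp : (r <= p ^ 4)%R).
{ replace r with (p ^ 4 - (1 - p) * (7 - p - p ^ 2 - p ^ 3))%R by (unfold p; field).
  assert (0 <= (1 - p) * (7 - p - p ^ 2 - p ^ 3))%R; [|lra].
  apply Rmult_le_pos; [lra|]. assert (p ^ 2 <= 1)%R by nra. assert (p ^ 3 <= 1)%R by nra. lra. }
destruct (Hc p Hp) as [M HM].
assert (HG : ex_series (fun n => scal (M * (/ (1 - p)) ^ 2)%R (p ^ n)%R)).
{ apply @ex_series_scal_l, ex_series_geom. rewrite Rabs_pos_eq; lra. }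
apply (@ex_series_le R_AbsRing R_CompleteNormedModule _ _) with (2 := HG).
intros n.
assert (Hn : (0 <= INR (S n))%R) by apply pos_INR.
assert (Hpn : (0 < p ^ n)%R) by (apply pow_lt; lra).
assert (Hrn : (0 <= r ^ n <= (p ^ n) ^ 4)%R).
{ split; [apply pow_le; lra|]. rewrite <- !pow_mult, Nat.mul_comm, pow_mult.
  now apply pow_incr. }
assert (Hq := INR_pow_bounded p Hp n).
specialize (HM n). pose proof (Cmod_ge_0 (c n)).
change (Rabs (Cmod (c n) * (INR (S n) ^ 2 * r ^ n)) <= M * (/ (1 - p)) ^ 2 * p ^ n)%R.
rewrite Rabs_pos_eq.
2:{ apply Rmult_le_pos; [assumption|]. apply Rmult_le_pos; [apply pow2_ge_0|lra]. }
apply Rle_trans with ((Cmod (c n) * p ^ n) * (INR (S n) * p ^ n) ^ 2 * p ^ n)%R.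
- replace ((Cmod (c n) * p ^ n) * (INR (S n) * p ^ n) ^ 2 * p ^ n)%R
    with (Cmod (c n) * (INR (S n) ^ 2 * (p ^ n) ^ 4))%R by ring.
  apply Rmult_le_compat_l; [assumption|]. apply Rmult_le_compat_l; [apply pow2_ge_0|lra].
- apply Rmult_le_compat_r; [lra|]. apply Rmult_le_compat; [nra|apply pow2_ge_0|assumption|].
  apply pow_incr. split; [|assumption]. nra.
Qed.

Lemma abel_bounded_analytic c : abel_bounded c -> analytic_coeffs_on_D c.
Proof.
intros Hc z Hz.
pose proof (abel_bounded_summable c (Cmod z) Hc (conj (Cmod_ge_0 z) Hz)) as Hs.
destruct (fun H => is_cseries_abs (fun n => c n * z ^ n) _ H Hs) as [L HL].
- intros n. rewrite Cmod_mult, Cmod_pow. apply Rmult_le_compat_l; [apply Cmod_ge_0|].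
  rewrite <- (Rmult_1_l (Cmod z ^ n)) at 1. apply Rmult_le_compat_r; [apply pow_le, Cmod_ge_0|].
  rewrite S_INR. pose proof (pos_INR n). nra.
- exists L. now apply is_series_converges.
Qed.

(** A bound at p for the coefficientwise product is the product of the bounds of the factors at sqrt
    p. *)
Lemma abel_bounded_mult c d : abel_bounded c -> abel_bounded d ->
  abel_bounded (fun n => c n * d n).
Proof.
intros Hc Hd p Hp.
assert (Hs : (0 < sqrt p < 1)%R).
{ split; [apply sqrt_lt_R0; lra|]. rewrite <- sqrt_1. apply sqrt_lt_1_alt; lra. }
destruct (Hc _ Hs) as [M HM]. destruct (Hd _ Hs) as [N HN].
exists (M * N)%R; intros n.
replace (Cmod (c n * d n) * p ^ n)%R with ((Cmod (c n) * sqrt p ^ n) * (Cmod (d n) * sqrt p ^ n))%R.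
- assert (0 <= sqrt p ^ n)%R by (apply pow_le; lra).
  apply Rmult_le_compat; auto; apply Rmult_le_pos; auto; apply Cmod_ge_0.
- rewrite Cmod_mult. rewrite <- (sqrt_sqrt p) at 3 by lra. rewrite Rpow_mult_distr. ring.
Qed.

Definition dcoeffs (c : nat -> C) (n : nat) : C := INR (S n) * c (S n).

Lemma abel_bounded_dcoeffs c : abel_bounded c -> abel_bounded (dcoeffs c).
Proof.
intros Hc p Hp.
destruct (ex_series_bounded _ (abel_bounded_summable c p Hc ltac:(lra))) as [M HM].
exists (M / p)%R; intros n.
apply Rmult_le_reg_r with p; [lra|]. replace (M / p * p)%R with M by (field; lra).
apply Rle_trans with (2 := HM (S n)).
eapply Rle_trans; [|apply Rle_abs].
unfold dcoeffs. rewrite Cmod_mult, Cmod_R, Rabs_pos_eq by apply pos_INR.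
pose proof (pos_INR n). pose proof (Cmod_ge_0 (c (S n))).
assert (0 <= Cmod (c (S n)) * p ^ n * p)%R.
{ apply Rmult_le_pos; [|lra]. apply Rmult_le_pos; [assumption|apply pow_le; lra]. }
rewrite !S_INR. simpl pow. nra.
Qed.

(** The remainder obeys E_(n+1) = u E_n + n z^(n-1) (u - z)^2. The factor r^2 on the left stands for
    r^(n-2) on the right, which makes no sense for n < 2. *)
Lemma Cpow_second_order (u z : C) (r : R) (n : nat) :
  (Cmod u <= r)%R -> (Cmod z <= r)%R ->
  (r ^ 2 * Cmod (u ^ n - z ^ n - INR n * z ^ pred n * (u - z)) <=
   INR (S n) ^ 2 * r ^ n * Cmod (u - z) ^ 2)%R.
Proof.
intros Hu Hz.
assert (Hr : (0 <= r)%R) by (pose proof (Cmod_ge_0 u); lra).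
set (q := (Cmod (u - z) ^ 2)%R). assert (Hq : (0 <= q)%R) by apply pow2_ge_0.
apply Rle_trans with (INR n ^ 2 * r ^ n * q)%R.
2:{ apply Rmult_le_compat_r; [assumption|]. apply Rmult_le_compat_r; [now apply pow_le|].
    rewrite S_INR. pose proof (pos_INR n). nra. }
induction n as [|n IH].
{ simpl. replace (1 - 1 - 0 * 1 * (u - z)) with (0 : C) by ring. rewrite Cmod_0. nra. }
set (E := u ^ n - z ^ n - INR n * z ^ pred n * (u - z)) in IH.
replace (u ^ S n - z ^ S n - INR (S n) * z ^ pred (S n) * (u - z))
  with (u * E + INR n * z ^ pred n * (u - z) ^ 2).
2:{ unfold E. rewrite S_INR, RtoC_plus. destruct n as [|n]; simpl; ring. }
assert (HT : (Cmod (u * E + INR n * z ^ pred n * (u - z) ^ 2) <=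
  r * Cmod E + INR n * r ^ pred n * q)%R).
{ eapply Rle_trans; [apply Cmod_triangle|].
  rewrite !Cmod_mult, !Cmod_pow, Cmod_R, (Rabs_pos_eq (INR n)) by apply pos_INR.
  apply Rplus_le_compat; [apply Rmult_le_compat_r; [apply Cmod_ge_0|assumption]|].
  apply Rmult_le_compat_r; [assumption|]. apply Rmult_le_compat_l; [apply pos_INR|].
  apply pow_incr; split; [apply Cmod_ge_0|assumption]. }
assert (Hn : (r ^ 2 * (INR n * r ^ pred n * q) = INR n * r ^ S n * q)%R).
{ destruct n as [|n]; simpl; ring. }
rewrite S_INR. assert (0 <= INR n)%R by apply pos_INR.
assert (0 <= r ^ S n * q)%R by (apply Rmult_le_pos; [now apply pow_le|assumption]).
apply Rle_trans with (r * (INR n ^ 2 * r ^ n * q) + INR n * r ^ S n * q)%R.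
- rewrite <- Hn. apply Rle_trans with (r ^ 2 * (r * Cmod E + INR n * r ^ pred n * q))%R.
  + apply Rmult_le_compat_l; [apply pow2_ge_0|assumption].
  + rewrite Rmult_plus_distr_l. apply Rplus_le_compat_r.
    replace (r ^ 2 * (r * Cmod E))%R with (r * (r ^ 2 * Cmod E))%R by ring.
    now apply Rmult_le_compat_l.
- simpl pow in *. nra.
Qed.

(** Summing the remainders of the powers bounds the remainder of the series by |u - z|^2 s / r^2,
    where s is the weighted sum of moduli at a radius r between |z| and 1. *)
Lemma is_cderive_series_sum c z : abel_bounded c -> (Cmod z < 1)%R ->
  is_cderive (series_sum c) z (series_sum (dcoeffs c) z).
Proof.
intros Hc Hz. pose proof (Cmod_ge_0 z) as Hz0.
set (r := ((1 + Cmod z) / 2)%R).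
assert (Hr : (Cmod z < r < 1 /\ 0 < r)%R) by (unfold r; lra).
destruct (abel_bounded_summable c r Hc ltac:(lra)) as [s Hs].
assert (Hs0 : (0 <= s)%R).
{ rewrite <- (Cmod_0). apply (is_cseries_Cmod_le (fun n => 0) _ 0 s) with (3 := Hs).
  - intros n. rewrite Cmod_0. apply Rmult_le_pos; [apply Cmod_ge_0|].
    apply Rmult_le_pos; [apply pow2_ge_0|apply pow_le; lra].
  - apply filterlim_ext with (fun _ => (0 : C)); [|apply filterlim_const].
    intros n. symmetry. apply (@sum_n_m_const_zero C_AbelianMonoid). }
apply is_cderive_iff. intros e He.
exists (Rmin (r - Cmod z) (e * r ^ 2 / (s + 1)))%R.
assert (Hr2 : (0 < r ^ 2)%R) by (apply pow_lt; lra).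
assert (Her : (0 < e * r ^ 2 / (s + 1))%R) by (apply Rdiv_lt_0_compat; nra).
split; [apply Rmin_pos; lra|]. intros u Hu.
pose proof (Rmin_l (r - Cmod z) (e * r ^ 2 / (s + 1))) as Hm1.
pose proof (Rmin_r (r - Cmod z) (e * r ^ 2 / (s + 1))) as Hm2.
assert (Hur : (Cmod u < r)%R).
{ replace u with (z + (u - z)) by ring. pose proof (Cmod_triangle z (u - z)). lra. }
pose proof (series_sum_correct c u (abel_bounded_analytic c Hc) ltac:(lra)) as Su.
pose proof (series_sum_correct c z (abel_bounded_analytic c Hc) Hz) as Sz.
pose proof (series_sum_correct _ z (abel_bounded_analytic _ (abel_bounded_dcoeffs c Hc)) Hz) as Sd.
(* The derived series is reindexed to start at n = 0 so that it can be subtracted termwise; the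
   added term vanishes because of its factor [INR 0]. *)
assert (Sd' : is_cseries (fun n => c n * (INR n * z ^ pred n)) (series_sum (dcoeffs c) z)).
{ apply (@is_series_decr_1 C_AbsRing C_NormedModule).
  change (is_cseries (fun k => c (S k) * (INR (S k) * z ^ k))
    (series_sum (dcoeffs c) z + - (c 0%nat * (INR 0 * 1)))).
  replace (series_sum (dcoeffs c) z + - (c 0%nat * (INR 0 * 1)))
    with (series_sum (dcoeffs c) z : C) by (simpl INR; cring).
  apply is_series_ext with (2 := Sd). intros n. unfold dcoeffs. cring. }
pose proof (@is_series_minus C_AbsRing C_NormedModule _ _ _ _ (@is_series_minus C_AbsRing C_NormedModule _ _ _ _ Su Sz)
  (@is_series_scal C_AbsRing C_NormedModule (u - z) _ _ Sd')) as SE.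
assert (Hb : (Cmod (series_sum c u - series_sum c z - series_sum (dcoeffs c) z * (u - z)) <=
  Cmod (u - z) ^ 2 / r ^ 2 * s)%R).
{ rewrite (Cmult_comm _ (u - z)).
  refine (is_cseries_Cmod_le _ _ _ _ _ SE (@is_series_scal R_AbsRing R_NormedModule (Cmod (u - z) ^ 2 / r ^ 2)%R _ _ Hs)).
  intros n.
  change (Cmod (c n * u ^ n + - (c n * z ^ n) + - ((u - z) * (c n * (INR n * z ^ pred n)))) <=
    Cmod (u - z) ^ 2 / r ^ 2 * (Cmod (c n) * (INR (S n) ^ 2 * r ^ n)))%R.
  replace (c n * u ^ n + - (c n * z ^ n) + - ((u - z) * (c n * (INR n * z ^ pred n))))
    with (c n * (u ^ n - z ^ n - INR n * z ^ pred n * (u - z))) by ring.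
  rewrite Cmod_mult.
  replace (Cmod (u - z) ^ 2 / r ^ 2 * (Cmod (c n) * (INR (S n) ^ 2 * r ^ n)))%R
    with (Cmod (c n) * (INR (S n) ^ 2 * r ^ n * Cmod (u - z) ^ 2 / r ^ 2))%R by (field; lra).
  apply Rmult_le_compat_l; [apply Cmod_ge_0|].
  apply Rmult_le_reg_l with (r ^ 2)%R; [assumption|].
  eapply Rle_trans; [apply (Cpow_second_order u z r n); lra|]. right; field; lra. }
apply Rle_trans with (1 := Hb).
pose proof (Cmod_ge_0 (u - z)).
assert (Cmod (u - z) / r ^ 2 * s <= e)%R.
{ apply Rmult_le_reg_r with (r ^ 2)%R; [assumption|].
  replace (Cmod (u - z) / r ^ 2 * s * r ^ 2)%R with (Cmod (u - z) * s)%R by (field; lra).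
  assert (Cmod (u - z) * (s + 1) <= e * r ^ 2)%R.
  { replace (e * r ^ 2)%R with (e * r ^ 2 / (s + 1) * (s + 1))%R by (field; lra).
    apply Rmult_le_compat_r; lra. }
  nra. }
replace (Cmod (u - z) ^ 2 / r ^ 2 * s)%R with (Cmod (u - z) / r ^ 2 * s * Cmod (u - z))%R by (field; lra).
now apply Rmult_le_compat_r.
Qed.

Lemma series_sum_linear (a b : nat -> C) (s t z : C) :
  abel_bounded a -> abel_bounded b -> (Cmod z < 1)%R ->
  series_sum (fun n => s * a n + t * b n) z = s * series_sum a z + t * series_sum b z.
Proof.
intros Ha Hb Hz. apply series_sum_unique.
pose proof (series_sum_correct a z (abel_bounded_analytic a Ha) Hz) as Sa.
pose proof (series_sum_correct b z (abel_bounded_analytic b Hb) Hz) as Sb.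
apply (@is_series_scal C_AbsRing C_NormedModule s) in Sa.
apply (@is_series_scal C_AbsRing C_NormedModule t) in Sb.
apply is_series_ext with (2 := @is_series_plus C_AbsRing C_NormedModule _ _ _ _ Sa Sb).
intros n. change (s * (a n * z ^ n) + t * (b n * z ^ n) = (s * a n + t * b n) * z ^ n). ring.
Qed.

Lemma series_sum_rotate (a : nat -> C) (s u z : C) :
  abel_bounded a -> (Cmod (u * z) < 1)%R ->
  series_sum (fun n => s * a n * u ^ n) z = s * series_sum a (u * z).
Proof.
intros Ha Hz. apply series_sum_unique.
pose proof (series_sum_correct a _ (abel_bounded_analytic a Ha) Hz) as Sa.
apply (@is_series_scal C_AbsRing C_NormedModule s) in Sa.
apply is_series_ext with (2 := Sa).
intros n. change (s * (a n * (u * z) ^ n) = s * a n * u ^ n * z ^ n).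
rewrite Cpow_mult_l. ring.
Qed.

Lemma series_sum_ext (a b : nat -> C) z : abel_bounded a -> (Cmod z < 1)%R ->
  (forall n, a n = b n) -> series_sum a z = series_sum b z.
Proof.
intros Ha Hz E. symmetry. apply series_sum_unique.
apply is_series_ext with (2 := series_sum_correct a z (abel_bounded_analytic a Ha) Hz).
intros n. now rewrite E.
Qed.

Lemma abel_bounded_linear (a b : nat -> C) (s t : C) :
  abel_bounded a -> abel_bounded b -> abel_bounded (fun n => s * a n + t * b n).
Proof.
intros Ha Hb p Hp. destruct (Ha p Hp) as [M HM]. destruct (Hb p Hp) as [N HN].
exists (Cmod s * M + Cmod t * N)%R; intros n. specialize (HM n). specialize (HN n).
assert (0 <= p ^ n)%R by (apply pow_le; lra).
apply Rle_trans with (Cmod s * (Cmod (a n) * p ^ n) + Cmod t * (Cmod (b n) * p ^ n))%R.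
- apply Rle_trans with ((Cmod s * Cmod (a n) + Cmod t * Cmod (b n)) * p ^ n)%R; [|right; ring].
  apply Rmult_le_compat_r; [assumption|]. rewrite <- !Cmod_mult. apply Cmod_triangle.
- apply Rplus_le_compat; apply Rmult_le_compat_l; try apply Cmod_ge_0; assumption.
Qed.

Lemma abel_bounded_rotate (a : nat -> C) (s u : C) :
  abel_bounded a -> Cmod u = 1%R -> abel_bounded (fun n => s * a n * u ^ n).
Proof.
intros Ha Hu p Hp. destruct (Ha p Hp) as [M HM].
exists (Cmod s * M)%R; intros n.
rewrite !Cmod_mult, Cmod_pow, Hu, pow1, Rmult_1_r, Rmult_assoc.
apply Rmult_le_compat_l; [apply Cmod_ge_0|apply HM].
Qed.

Lemma abel_bounded_geom : abel_bounded (fun _ => 1 : C).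
Proof.
intros p Hp. exists 1%R; intros n. rewrite Cmod_1, Rmult_1_l.
rewrite <- (pow1 n). apply pow_incr; lra.
Qed.

Lemma Cmod_1_minus (z : C) : (Cmod z < 1)%R -> 1 - z <> 0.
Proof.
intros Hz E. assert (z = 1) by (rewrite <- (Cplus_0_r z), <- E; ring).
subst z. rewrite Cmod_1 in Hz. lra.
Qed.

Lemma series_sum_geom (z : C) : (Cmod z < 1)%R -> series_sum (fun _ => 1 : C) z = / (1 - z).
Proof.
intros Hz.
pose proof (series_sum_correct _ z (abel_bounded_analytic _ abel_bounded_geom) Hz) as S.
set (L := series_sum (fun _ => 1 : C) z : C) in *.
change (L = / (1 - z)). clearbody L.
assert (S' : is_cseries (fun n => 1 * z ^ n) (1 + z * L)).
{ apply (@is_series_decr_1 C_AbsRing C_NormedModule).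
  change (is_cseries (fun k => 1 * (z * z ^ k)) (1 + z * L + - (1 * 1))).
  replace (1 + z * L + - (1 * 1)) with (z * L) by ring.
  apply is_series_ext with (2 := @is_series_scal C_AbsRing C_NormedModule z _ _ S).
  intros n. change (z * (1 * z ^ n) = 1 * (z * z ^ n)). ring. }
pose proof (is_series_unique_C _ _ _ S S') as E.
pose proof (Cmod_1_minus z Hz) as Hn.
assert (E' : (1 - z) * L = 1).
{ replace ((1 - z) * L) with (L - (1 + z * L) + 1) by ring. rewrite <- E. cring. }
replace L with (/ (1 - z) * ((1 - z) * L)) by (field; assumption). rewrite E'. ring.
Qed.

Lemma series_sum_0 (a : nat -> C) : series_sum a (0 : C) = a 0%nat.
Proof.
apply series_sum_unique, (@is_series_decr_1 C_AbsRing C_NormedModule).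
change (is_cseries (fun k => a (S k) * (0 * 0 ^ k)) (a 0%nat + - (a 0%nat * 1))).
replace (a 0%nat + - (a 0%nat * 1)) with (0 : C) by ring.
apply filterlim_ext with (fun _ => (0 : C)); [|apply filterlim_const].
intros n. symmetry.
transitivity (@sum_n C_AbelianMonoid (fun _ => zero) n); [|apply (@sum_n_m_const_zero C_AbelianMonoid)].
apply sum_n_ext. intros k. change (a (S k) * (0 * 0 ^ k) = 0). ring.
Qed.

(** * Rules for complex derivatives and the passage to real partial derivatives *)

Lemma is_cderive_ext_disc (f g : C -> C) (z d : C) : (Cmod z < 1)%R ->
  (forall u, (Cmod u < 1)%R -> f u = g u) -> is_cderive f z d -> is_cderive g z d.
Proof.
intros Hz E Hf. rewrite is_cderive_iff in Hf |- *. intros e He.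
destruct (Hf e He) as (r & Hr & H).
exists (Rmin r (1 - Cmod z)); split; [apply Rmin_pos; lra|]. intros u Hu.
pose proof (Rmin_l r (1 - Cmod z)). pose proof (Rmin_r r (1 - Cmod z)).
rewrite <- (E z Hz), <- (E u).
- apply H. lra.
- replace u with (z + (u - z)) by ring. pose proof (Cmod_triangle z (u - z)). lra.
Qed.

Lemma is_cderive_minus (f g : C -> C) (z a b : C) : is_cderive f z a -> is_cderive g z b ->
  is_cderive (fun w => f w - g w) z (a - b).
Proof. exact (@is_derive_minus C_AbsRing (AbsRing_NormedModule C_AbsRing) f g z a b). Qed.

Lemma is_cderive_plus (f g : C -> C) (z a b : C) : is_cderive f z a -> is_cderive g z b ->
  is_cderive (fun w => f w + g w) z (a + b).
Proof. exact (@is_derive_plus C_AbsRing (AbsRing_NormedModule C_AbsRing) f g z a b). Qed.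

Lemma is_cderive_mult (f g : C -> C) (z a b : C) : is_cderive f z a -> is_cderive g z b ->
  is_cderive (fun w => f w * g w) z (a * g z + f z * b).
Proof.
intros Hf Hg. exact (@is_derive_mult C_AbsRing f g z a b Hf Hg Cmult_comm).
Qed.

Lemma is_cderive_comp (f g : C -> C) (z a b : C) : is_cderive f (g z) a -> is_cderive g z b ->
  is_cderive (fun w => f (g w)) z (b * a).
Proof. exact (@is_derive_comp C_AbsRing (AbsRing_NormedModule C_AbsRing) f g z a b). Qed.

Lemma is_cderive_const (a z : C) : is_cderive (fun _ => a) z 0.
Proof. exact (@is_derive_const C_AbsRing (AbsRing_NormedModule C_AbsRing) a z). Qed.

Lemma is_cderive_id (z : C) : is_cderive (fun w => w) z 1.
Proof. exact (@is_derive_id C_AbsRing z). Qed.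

Lemma is_cderive_inv (z : C) : z <> 0 -> is_cderive Complex.Cinv z (- / (z * z)).
Proof.
intros Hz. pose proof (proj1 (Cmod_gt_0 z) Hz) as Hm.
apply is_cderive_iff. intros e He.
set (m := Cmod z) in *.
assert (Hm3 : (0 < m ^ 3)%R) by now apply pow_lt.
(* The remainder is exactly (u - z)^2 / (z^2 u); with |u| >= m / 2 its modulus is at most 2 |u -
   z|^2 / m^3. *)
exists (Rmin (m / 2) (e * m ^ 3 / 2))%R; split; [apply Rmin_pos; nra|]. intros u Hu.
pose proof (Rmin_l (m / 2) (e * m ^ 3 / 2)). pose proof (Rmin_r (m / 2) (e * m ^ 3 / 2)).
assert (Hum : (m / 2 <= Cmod u)%R).
{ pose proof (Cmod_triangle u (z - u)) as HT. replace (u + (z - u)) with z in HT by ring.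
  fold m in HT. replace (z - u) with (- (u - z)) in HT by ring. rewrite Cmod_opp in HT. lra. }
assert (Hu0 : u <> 0) by (intros E; rewrite E, Cmod_0 in Hum; lra).
replace (/ u - / z - - / (z * z) * (u - z)) with ((u - z) * ((u - z) / (z * z * u))) by (field; tauto).
rewrite Cmod_mult, Rmult_comm. apply Rmult_le_compat_r; [apply Cmod_ge_0|].
assert (Hzu : z * z * u <> 0) by (repeat apply Cmult_neq_0; assumption).
rewrite Cmod_div by assumption.
rewrite !Cmod_mult. fold m.
apply Rmult_le_reg_r with (m * m * Cmod u)%R; [repeat apply Rmult_lt_0_compat; lra|].
unfold Rdiv at 1. rewrite Rmult_assoc, Rinv_l, Rmult_1_r.
2:{ assert (0 < m * m * Cmod u)%R by (repeat apply Rmult_lt_0_compat; lra). lra. }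
apply Rle_trans with (e * m ^ 3 / 2)%R; [lra|].
replace (e * m ^ 3 / 2)%R with (e * (m * m) * (m / 2))%R by field.
rewrite <- (Rmult_assoc e (m * m)%R (Cmod u)). apply Rmult_le_compat_l; [nra|assumption].
Qed.

Lemma is_cderive_continuity_2d (f : C -> C) (x y : R) (d : C) : is_cderive f (x, y) d ->
  continuity_2d_pt (fun u v => Re (f (u, v))) x y /\ continuity_2d_pt (fun u v => Im (f (u, v))) x y.
Proof.
intros Hd. rewrite is_cderive_iff in Hd.
assert (Hc : forall e : R, (0 < e)%R -> exists r : posreal, forall u v,
  (Rabs (u - x) < r)%R -> (Rabs (v - y) < r)%R -> (Cmod (f (u, v) - f (x, y)) < e)%R).
{ intros e He. destruct (Hd 1%R Rlt_0_1) as (r & Hr & H).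
  pose proof (Cmod_ge_0 d).
  set (q := (e / (2 * (2 + Cmod d)))%R).
  assert (Hq : (0 < q)%R) by (apply Rdiv_lt_0_compat; lra).
  assert (Hm : (0 < Rmin (r / 2) q)%R) by (apply Rmin_pos; lra).
  exists (mkposreal _ Hm). simpl. intros u v Hu Hv.
  pose proof (Rmin_l (r / 2) q). pose proof (Rmin_r (r / 2) q).
  assert (HC : (Cmod ((u, v) - (x, y)) <= Rabs (u - x) + Rabs (v - y))%R).
  { replace ((u, v) - (x, y)) with ((u - x)%R + Ci * (v - y)%R)
      by (unfold Ci, Complex.RtoC, Cplus, Cmult, Cminus, Cplus, Complex.Copp; simpl; f_equal; ring).
    eapply Rle_trans; [apply Cmod_triangle|]. rewrite Cmod_mult, Cmod_Ci, !Cmod_R. lra. }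
  specialize (H (u, v)). cbv beta in H.
  specialize (H ltac:(lra)).
  pose proof (Cmod_triangle (f (u, v) - f (x, y) - d * ((u, v) - (x, y))) (d * ((u, v) - (x, y)))) as HT.
  replace (f (u, v) - f (x, y) - d * ((u, v) - (x, y)) + d * ((u, v) - (x, y)))
    with (f (u, v) - f (x, y)) in HT by ring.
  rewrite Cmod_mult in HT.
  assert (Cmod ((u, v) - (x, y)) < 2 * q)%R by lra.
  assert (2 * q * (2 + Cmod d) = e)%R by (unfold q; field; lra).
  pose proof (Cmod_ge_0 ((u, v) - (x, y))).
  nra. }
split; intros e; destruct (Hc e (cond_pos e)) as [r Hr]; exists r; intros u v Hu Hv;
  apply Rle_lt_trans with (2 := Hr u v Hu Hv); pose proof (Rmax_Cmod (f (u, v) - f (x, y))) as HM;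
  apply Rle_trans with (2 := HM); [apply Rmax_l|apply Rmax_r].
Qed.

(** The Cauchy-Riemann formulas needed for U = Im Q. The last one is meant for Q': as U_y = Re Q',
    it yields U_yy. *)
Lemma is_cderive_partial (f : C -> C) (x y : R) (d : C) : is_cderive f (x, y) d ->
  is_derive (fun t => Im (f (t, y))) x (Im d) /\ is_derive (fun t => Im (f (x, t))) y (Re d) /\
  is_derive (fun t => Re (f (x, t))) y (- Im d)%R.
Proof.
intros Hd. rewrite is_cderive_iff in Hd.
assert (Hx : forall t : R, (t, y) - (x, y) = (t - x)%R).
{ intros t. unfold Complex.RtoC, Cminus, Cplus, Complex.Copp; simpl; f_equal; ring. }
assert (Hy : forall t : R, (x, t) - (x, y) = Ci * (t - y)%R).
{ intros t. unfold Ci, Complex.RtoC, Cminus, Cplus, Cmult, Complex.Copp; simpl; f_equal; ring. }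
assert (HCi : forall t : R, Cmod (Ci * t) = Rabs t).
{ intros t. rewrite Cmod_mult, Cmod_Ci, Cmod_R. ring. }
assert (HL : forall (phi : R -> R) (t0 l : R),
  (forall e : R, (0 < e)%R -> exists r : R, (0 < r)%R /\ forall t, (Rabs (t - t0) < r)%R ->
     (Rabs (phi t - phi t0 - l * (t - t0)) <= e * Rabs (t - t0))%R) -> is_derive phi t0 l).
{ intros phi t0 l H. apply is_derive_Reals. intros e He.
  destruct (H (e / 2)%R) as (r & Hr & H'); [lra|].
  exists (mkposreal r Hr). intros h Hh Hhr. specialize (H' (t0 + h)%R).
  replace (t0 + h - t0)%R with h in H' by ring. specialize (H' Hhr).
  replace ((phi (t0 + h) - phi t0) / h - l)%R with ((phi (t0 + h) - phi t0 - l * h) / h)%R by (field; assumption).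
  unfold Rdiv. rewrite Rabs_mult, Rabs_inv. pose proof (Rabs_pos_lt h Hh).
  apply Rmult_lt_reg_r with (Rabs h); [assumption|]. rewrite Rmult_assoc, Rinv_l, Rmult_1_r by lra. nra. }
split; [|split]; apply HL; intros e He; destruct (Hd e He) as (r & Hr & H); exists r; (split; [assumption|]);
  intros t Ht.
- specialize (H (t, y)). cbv beta in H. rewrite Hx, !Cmod_R in H. specialize (H Ht).
  apply Rle_trans with (2 := H). eapply Rle_trans; [|apply Rmax_Cmod].
  eapply Rle_trans; [|apply Rmax_r]. right. f_equal. simpl. unfold Re, Im. ring.
- specialize (H (x, t)). cbv beta in H. rewrite Hy, !HCi in H. specialize (H Ht).
  apply Rle_trans with (2 := H). eapply Rle_trans; [|apply Rmax_Cmod].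
  eapply Rle_trans; [|apply Rmax_r]. right. f_equal. simpl. unfold Re, Im. ring.
- specialize (H (x, t)). cbv beta in H. rewrite Hy, !HCi in H. specialize (H Ht).
  apply Rle_trans with (2 := H). eapply Rle_trans; [|apply Rmax_Cmod].
  eapply Rle_trans; [|apply Rmax_l]. right. f_equal. simpl. unfold Re, Im. ring.
Qed.

(** Identity theorem by repeated differentiation: each derivative of a constant sum is again
    constant, namely 0, and its value at 0 gives the next coefficient up to a positive integer
    factor. *)
Lemma series_sum_const_coeffs (n : nat) : forall (a : nat -> C) (K : C), abel_bounded a ->
  (forall z, (Cmod z < 1)%R -> series_sum a z = K) -> a (S n) = 0.
Proof.
assert (Hd : forall (a : nat -> C) (K : C), abel_bounded a ->
  (forall z, (Cmod z < 1)%R -> series_sum a z = K) ->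
  forall z, (Cmod z < 1)%R -> series_sum (dcoeffs a) z = (0 : C)).
{ intros a K Ha HK z Hz. apply (is_cderive_unique (series_sum a) z); [now apply is_cderive_series_sum|].
  apply (is_cderive_ext_disc (fun _ => K)); [assumption| |apply is_cderive_const].
  intros u Hu. symmetry. now apply HK. }
assert (Hc : forall a m, dcoeffs a m = 0 -> a (S m) = 0).
{ intros a m E. apply NNPP; intros Hn. revert E. apply Cmult_neq_0; [|assumption].
  intros E. apply RtoC_inj in E. apply not_0_INR in E; [assumption|lia]. }
induction n as [|n IH]; intros a K Ha HK; apply Hc.
- rewrite <- series_sum_0. apply (Hd a K); auto. rewrite Cmod_0. lra.
- apply (IH _ (0 : C)); [now apply abel_bounded_dcoeffs|now apply (Hd a K)].
Qed.

Lemma series_sum_dcoeffs_geom (z : C) : (Cmod z < 1)%R ->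
  series_sum (dcoeffs (fun _ => 1 : C)) z * (1 - z) ^ 2 = 1.
Proof.
intros Hz. pose proof (Cmod_1_minus z Hz) as Hn.
rewrite (is_cderive_unique (series_sum (fun _ => 1 : C)) z
  (series_sum (dcoeffs (fun _ => 1 : C)) z) ((0 - 1) * - / ((1 - z) * (1 - z)))).
- field. assumption.
- apply is_cderive_series_sum; [apply abel_bounded_geom|assumption].
- apply (is_cderive_ext_disc (fun w => / (1 - w))); [assumption| |].
  + intros u Hu. symmetry. now apply series_sum_geom.
  + exact (is_cderive_comp _ _ _ _ _ (is_cderive_inv (1 - z) Hn)
      (is_cderive_minus _ _ _ _ _ (is_cderive_const 1 z) (is_cderive_id z))).
Qed.

(** * The shear construction in the disc *)

(** The inverse w / (1 + w) of z / (1 - z). In this form 1 - m = 1 / (1 + w), whence m' = (1 - m)^2,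
    the factor in the positivity condition. *)
Definition halfplane_to_disc (w : C) : C := 1 - / (1 + w).

Lemma halfplane_neq (w : C) : (- (1 / 2) < Re w)%R -> 1 + w <> 0.
Proof.
intros Hw E. apply (f_equal Re) in E. change (1 + Re w = 0)%R in E. lra.
Qed.

Lemma halfplane_to_disc_lt_1 (w : C) : (- (1 / 2) < Re w)%R -> (Cmod (halfplane_to_disc w) < 1)%R.
Proof.
intros Hw. pose proof (halfplane_neq w Hw) as Hn. pose proof (proj1 (Cmod_gt_0 _) Hn) as Hm.
unfold halfplane_to_disc. replace (1 - / (1 + w)) with (w / (1 + w)) by (field; assumption).
rewrite Cmod_div by assumption.
apply Rmult_lt_reg_r with (Cmod (1 + w)); [assumption|].
unfold Rdiv. rewrite Rmult_assoc, Rinv_l, Rmult_1_r, Rmult_1_l by lra.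
apply sqrt_lt_1_alt. split; [pose proof (pow2_ge_0 (fst w)); pose proof (pow2_ge_0 (snd w)); lra|].
unfold Re in Hw. simpl. nra.
Qed.

Lemma disc_preimage (z : C) : (Cmod z < 1)%R ->
  exists w, (- (1 / 2) < Re w)%R /\ halfplane_to_disc w = z.
Proof.
intros Hz. pose proof (Cmod_1_minus z Hz) as Hn.
exists (z / (1 - z)). split.
- assert (Hsq : (fst z ^ 2 + snd z ^ 2 < 1)%R).
  { rewrite <- sqrt_1 in Hz. now apply sqrt_lt_0_alt in Hz. }
  assert (Hd : (0 < (1 - fst z) ^ 2 + snd z ^ 2)%R) by nra.
  replace (Re (z / (1 - z))) with ((fst z * (1 - fst z) - snd z ^ 2) / ((1 - fst z) ^ 2 + snd z ^ 2))%R.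
  + apply Rmult_lt_reg_r with ((1 - fst z) ^ 2 + snd z ^ 2)%R; [assumption|].
    unfold Rdiv. rewrite (Rmult_assoc _ (/ _)%R), Rinv_l, Rmult_1_r by lra. nra.
  + unfold Re, Complex.Cdiv. simpl. field. simpl in Hd. lra.
- unfold halfplane_to_disc. field. split; [assumption|].
  replace (1 - z + z) with (1 : C) by ring. exact C1_nz.
Qed.

Lemma halfplane_to_disc_inj (w w' : C) : (- (1 / 2) < Re w)%R -> (- (1 / 2) < Re w')%R ->
  halfplane_to_disc w = halfplane_to_disc w' -> w = w'.
Proof.
intros Hw Hw' E. pose proof (halfplane_neq w Hw). pose proof (halfplane_neq w' Hw').
unfold halfplane_to_disc in E.
assert (E' : / (1 + w) = / (1 + w')).
{ replace (/ (1 + w)) with (1 - (1 - / (1 + w))) by ring. rewrite E. ring. }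
replace w with (/ / (1 + w) - 1) by (field; repeat split; auto using C1_nz).
rewrite E'. field; repeat split; auto using C1_nz.
Qed.

Lemma is_cderive_halfplane_to_disc (w : C) : (- (1 / 2) < Re w)%R ->
  is_cderive halfplane_to_disc w ((1 - halfplane_to_disc w) ^ 2).
Proof.
intros Hw. pose proof (halfplane_neq w Hw) as Hn.
pose proof (is_cderive_comp _ _ _ _ _ (is_cderive_inv (1 + w) Hn)
  (is_cderive_plus _ _ _ _ _ (is_cderive_const 1 w) (is_cderive_id w))) as H.
pose proof (is_cderive_minus _ _ _ _ _ (is_cderive_const 1 w) H) as H'.
replace ((1 - halfplane_to_disc w) ^ 2) with (0 - (0 + 1) * (- / ((1 + w) * (1 + w)))); [exact H'|].
unfold halfplane_to_disc. field. assumption.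
Qed.

(* Clunie--Sheil-Small shear construction along the real axis, in the case where [A - B] satisfies the Royster--Ziegler condition with both nodes at 1. *)
Lemma disc_shear (A B : nat -> C) :
  abel_bounded A -> abel_bounded B ->
  (forall z, (Cmod z < 1)%R ->
     (0 < Re ((series_sum (dcoeffs A) z - series_sum (dcoeffs B) z) * (1 - z) ^ 2)%C)%R) ->
  locally_univalent_on_D (harmonic_of A B) ->
  forall z1 z2, (Cmod z1 < 1)%R -> (Cmod z2 < 1)%R ->
  Im (harmonic_of A B z1) = Im (harmonic_of A B z2) ->
  (Re (harmonic_of A B z1) = Re (harmonic_of A B z2) -> z1 = z2) /\
  (forall t, (Rmin (Re (harmonic_of A B z1)) (Re (harmonic_of A B z2)) <= t <=
              Rmax (Re (harmonic_of A B z1)) (Re (harmonic_of A B z2)))%R ->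
     exists z, (Cmod z < 1)%R /\ harmonic_of A B z = (t, Im (harmonic_of A B z1))).
Proof.
intros HA HB Hpos Hloc.
set (F := harmonic_of A B) in *.
pose proof (abel_bounded_dcoeffs _ HA) as HA1. pose proof (abel_bounded_dcoeffs _ HB) as HB1.
set (m := halfplane_to_disc).
assert (Hm : forall x y, (- (1 / 2) < x)%R -> (Cmod (m (x, y)) < 1)%R).
{ intros x y Hx. now apply halfplane_to_disc_lt_1. }
assert (Hdm : forall x y, (- (1 / 2) < x)%R -> is_cderive m (x, y) ((1 - m (x, y)) ^ 2)).
{ intros x y Hx. now apply is_cderive_halfplane_to_disc. }
assert (Hds : forall c x y, abel_bounded c -> (- (1 / 2) < x)%R ->
  is_cderive (fun w => series_sum c (m w)) (x, y) ((1 - m (x, y)) ^ 2 * series_sum (dcoeffs c) (m (x, y)))).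
{ intros c x y Hc Hx.
  apply is_cderive_comp; [apply is_cderive_series_sum; auto|now apply Hdm]. }
set (Q := fun w : C => series_sum A (m w) - series_sum B (m w)).
set (D := fun w : C => series_sum (dcoeffs A) (m w) - series_sum (dcoeffs B) (m w)).
set (Q1 := fun w : C => (1 - m w) * (1 - m w) * D w).
assert (HQ : forall x y, (- (1 / 2) < x)%R -> is_cderive Q (x, y) (Q1 (x, y))).
{ intros x y Hx.
  replace (Q1 (x, y)) with ((1 - m (x, y)) ^ 2 * series_sum (dcoeffs A) (m (x, y)) -
    (1 - m (x, y)) ^ 2 * series_sum (dcoeffs B) (m (x, y))) by (unfold Q1, D; ring).
  apply is_cderive_minus; now apply Hds. }
(* Only the existence of Q'' matters: the second partial derivatives of Im Q are Im Q'' and - Im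
   Q'', so Laplace's equation is immediate whatever its value. *)
assert (HQ1 : forall x y, exists d : C, (- (1 / 2) < x)%R -> is_cderive Q1 (x, y) d).
{ intros x y.
  destruct (Rlt_dec (- (1 / 2)) x) as [Hx|Hx]; [|exists 0; tauto].
  eexists; intros _.
  pose proof (is_cderive_minus _ _ _ _ _ (is_cderive_const 1 (x, y)) (Hdm x y Hx)) as H1.
  exact (is_cderive_mult _ _ _ _ _ (is_cderive_mult _ _ _ _ _ H1 H1)
    (is_cderive_minus _ _ _ _ _ (Hds _ x y HA1 Hx) (Hds _ x y HB1 Hx))). }
set (Q2 := fun x y => proj1_sig (constructive_indefinite_description _ (HQ1 x y))).
assert (HQ2 : forall x y, (- (1 / 2) < x)%R -> is_cderive Q1 (x, y) (Q2 x y)).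
{ intros x y; unfold Q2; now destruct constructive_indefinite_description. }
assert (HU : upward_harmonic (- (1 / 2)) (fun x y => Im (Q (x, y)))
  (fun x y => Im (Q1 (x, y))) (fun x y => Re (Q1 (x, y)))
  (fun x y => Im (Q2 x y)) (fun x y => - Im (Q2 x y))%R).
{ split; intros x y Hx.
  - exact (proj2 (is_cderive_continuity_2d _ _ _ _ (HQ x y Hx))).
  - exact (proj1 (is_cderive_partial _ _ _ _ (HQ x y Hx))).
  - exact (proj1 (proj2 (is_cderive_partial _ _ _ _ (HQ x y Hx)))).
  - exact (proj1 (is_cderive_partial _ _ _ _ (HQ2 x y Hx))).
  - exact (proj2 (proj2 (is_cderive_partial _ _ _ _ (HQ2 x y Hx)))).
  - ring.
  - replace (Q1 (x, y)) with (D (x, y) * (1 - m (x, y)) ^ 2) by (unfold Q1; ring).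
    apply Hpos. now apply Hm. }
set (V := fun x y => Re (F (m (x, y)))).
assert (HIm : forall w, Im (Q w) = Im (F (m w))) by reflexivity.
assert (HV : forall x y, (- (1 / 2) < x)%R -> continuity_2d_pt V x y).
{ intros x y Hx. apply continuity_2d_pt_plus.
  - exact (proj1 (is_cderive_continuity_2d _ _ _ _ (Hds A x y HA Hx))).
  - exact (proj1 (is_cderive_continuity_2d _ _ _ _ (Hds B x y HB Hx))). }
assert (Hinj : forall x y, (- (1 / 2) < x)%R -> exists r, (0 < r)%R /\
  forall u v u' v', (- (1 / 2) < u)%R -> (- (1 / 2) < u')%R ->
     (Rabs (u - x) < r)%R -> (Rabs (v - y) < r)%R -> (Rabs (u' - x) < r)%R -> (Rabs (v' - y) < r)%R ->
     Im (Q (u, v)) = Im (Q (u', v')) -> V u v = V u' v' -> u = u' /\ v = v').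
{ intros x y Hx. destruct (Hloc (m (x, y)) (Hm x y Hx)) as (r & Hr & H).
  destruct (is_cderive_continuity_2d _ _ _ _ (Hdm x y Hx)) as [Hc1 Hc2].
  destruct (Hc1 (mkposreal (r / 2) ltac:(lra))) as [d1 Hd1].
  destruct (Hc2 (mkposreal (r / 2) ltac:(lra))) as [d2 Hd2].
  simpl in Hd1, Hd2.
  assert (Hnear : forall u v, (Rabs (u - x) < Rmin d1 d2)%R -> (Rabs (v - y) < Rmin d1 d2)%R ->
    (Cmod (m (u, v) - m (x, y))%C < r)%R).
  { intros u v Hu Hv. pose proof (Rmin_l d1 d2). pose proof (Rmin_r d1 d2).
    specialize (Hd1 u v ltac:(lra) ltac:(lra)). specialize (Hd2 u v ltac:(lra) ltac:(lra)).
    set (k := m (u, v) - m (x, y)).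
    assert (Ek : k = (Re k : R) + Ci * (Im k : R)).
    { unfold Ci, Complex.RtoC, Cplus, Cmult, Re, Im. destruct k; simpl; f_equal; ring. }
    rewrite Ek. eapply Rle_lt_trans; [apply Cmod_triangle|].
    rewrite Cmod_mult, Cmod_Ci, !Cmod_R.
    change (Rabs (Re k) < r / 2)%R in Hd1. change (Rabs (Im k) < r / 2)%R in Hd2. lra. }
  exists (Rmin d1 d2); split; [apply Rmin_pos; apply cond_pos|].
  intros u v u' v' Hu Hu' H1 H2 H3 H4 E1 E2.
  assert (E : m (u, v) = m (u', v')).
  { apply H; try (apply Hm; assumption); try (apply Hnear; assumption).
    apply injective_projections; assumption. }
  apply halfplane_to_disc_inj in E; [|assumption|assumption]. now inversion E. }
assert (Hmain : forall x1 y1 x2 y2, (- (1 / 2) < x1)%R -> (x1 <= x2)%R ->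
  Im (F (m (x1, y1))) = Im (F (m (x2, y2))) ->
  (V x1 y1 = V x2 y2 -> m (x1, y1) = m (x2, y2)) /\
  (forall t, (Rmin (V x1 y1) (V x2 y2) <= t <= Rmax (V x1 y1) (V x2 y2))%R ->
     exists z, (Cmod z < 1)%R /\ F z = (t, Im (F (m (x1, y1)))))).
{ intros x1 y1 x2 y2 Hx1 Hx E.
  destruct (halfplane_shear _ _ _ _ _ _ V HU HV Hinj x1 y1 x2 y2 Hx1 Hx E) as [H1 H2].
  split.
  - intros EV. destruct (H1 EV) as [-> ->]. reflexivity.
  - intros t Ht. destruct (H2 t Ht) as (x & y & Hx' & E1 & E2).
    exists (m (x, y)). split; [now apply Hm|]. apply injective_projections; assumption. }
intros z1 z2 Hz1 Hz2 E.
destruct (disc_preimage z1 Hz1) as ([x1 y1] & Hx1 & <-).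
destruct (disc_preimage z2 Hz2) as ([x2 y2] & Hx2 & <-).
simpl in Hx1, Hx2. fold m in E |- *.
destruct (Rle_dec x1 x2) as [Hx|Hx].
- now apply Hmain.
- destruct (Hmain x2 y2 x1 y1 Hx2 ltac:(lra) (eq_sym E)) as [H1 H2]. split.
  + intros EV. symmetry. now apply H1.
  + intros t Ht. rewrite E. apply H2. now rewrite Rmin_comm, Rmax_comm.
Qed.

(** * Half-plane mappings and their convolution *)

Lemma cderiv_at_is_cderive (f : C -> C) (z d : C) : cderiv_at f z d -> is_cderive f z d.
Proof.
intros H. apply is_cderive_iff. intros e He. destruct (H e He) as (r & Hr & H').
exists r; split; [assumption|]. intros u Hu.
destruct (Req_dec (Cmod (u - z)) 0) as [E|E].
{ apply Cmod_eq_0 in E. assert (u = z) by now apply Ceq_minus. subst u.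
  replace (f z - f z - d * (z - z)) with (0 : C) by ring. rewrite Cmod_0, E, Cmod_0. lra. }
assert (H0 : (0 < Cmod (u - z))%R) by (destruct (Cmod_ge_0 (u - z)); [assumption|congruence]).
specialize (H' (u - z) (conj H0 Hu)).
change (Cmod ((f (z + (u - z))%C - f z) / (u - z) - d) < e)%R in H'.
replace (z + (u - z)) with u in H' by ring.
assert (Hn : u - z <> 0) by (intros E'; apply E; rewrite E'; apply Cmod_0).
replace (f u - f z - d * (u - z)) with (((f u - f z) / (u - z) - d) * (u - z)) by (field; assumption).
rewrite Cmod_mult. apply Rmult_le_compat_r; lra.
Qed.

Lemma sense_preserving_dcoeffs (h k : nat -> C) (z : C) :
  abel_bounded h -> abel_bounded k -> sense_preserving h k -> (Cmod z < 1)%R ->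
  (Cmod (series_sum (dcoeffs k) z) < Cmod (series_sum (dcoeffs h) z))%R.
Proof.
intros Hh Hk Hs Hz. destruct (Hs z Hz) as (dh & dg & H1 & H2 & H3).
apply cderiv_at_is_cderive in H1, H2.
rewrite <- (is_cderive_unique _ _ _ _ H1 (is_cderive_series_sum h z Hh Hz)).
rewrite <- (is_cderive_unique _ _ _ _ H2 (is_cderive_series_sum k z Hk Hz)).
exact H3.
Qed.

(* [(a - b) X] times the conjugate of [(a + b) X = c] has real part [(|a|^2 - |b|^2) |X|^2]. *)
Lemma Re_pos_of_dominated (a b X : C) (c : R) : (0 < c)%R -> (Cmod b < Cmod a)%R ->
  (a + b) * X = c -> (0 < Re ((a - b) * X)%C)%R.
Proof.
intros Hc Hab E.
apply sqrt_lt_0_alt in Hab.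
destruct a as [a1 a2], b as [b1 b2], X as [x1 x2]. simpl in Hab.
apply (f_equal Re) in E as E1. apply (f_equal Im) in E as E2.
unfold Re, Im in *. simpl in *.
assert (Hx : (0 < x1 ^ 2 + x2 ^ 2)%R).
{ destruct (Req_dec x1 0) as [->|H1]; [destruct (Req_dec x2 0) as [->|H2]|]; [exfalso; lra| |]; nra. }
apply Rmult_lt_reg_r with c; [assumption|]. rewrite Rmult_0_l.
replace (((a1 + - b1) * x1 - (a2 + - b2) * x2) * c)%R
  with ((x1 ^ 2 + x2 ^ 2) * (a1 * (a1 * 1) + a2 * (a2 * 1) - (b1 * (b1 * 1) + b2 * (b2 * 1))))%R.
- apply Rmult_lt_0_compat; lra.
- transitivity (((a1 + - b1) * x1 - (a2 + - b2) * x2) * ((a1 + b1) * x1 - (a2 + b2) * x2) +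
    ((a1 + - b1) * x2 + (a2 + - b2) * x1) * ((a1 + b1) * x2 + (a2 + b2) * x1))%R; [ring|].
  rewrite E1, E2. ring.
Qed.

(* [u] and [v] are e^{i theta} and e^{-i theta}; rotating by theta turns the shear identity into [H + G = c z / (1 - z)]. *)
Lemma halfplane_map_rotated (h k : nat -> C) (c : R) (u v : C) :
  u * v = 1 -> Cmod v = 1%R -> (0 < c)%R ->
  abel_bounded h -> abel_bounded k -> sense_preserving h k ->
  (forall z, (Cmod z < 1)%R ->
     series_sum h z + v ^ 2 * series_sum k z = c * z / (1 - u * z)) ->
  let H := fun n => u * h n * v ^ n in
  let G := fun n => v * k n * v ^ n in
  (forall n, H (S n) + G (S n) = c) /\
  (forall z, (Cmod z < 1)%R ->
     (0 < Re ((series_sum (dcoeffs H) z - series_sum (dcoeffs G) z) * (1 - z) ^ 2)%C)%R).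
Proof.
intros Huv Hv Hc Hh Hk Hs E H G.
assert (HH : abel_bounded H) by now apply abel_bounded_rotate.
assert (HG : abel_bounded G) by now apply abel_bounded_rotate.
assert (Hvz : forall z, (Cmod z < 1)%R -> (Cmod (v * z) < 1)%R).
{ intros z Hz. rewrite Cmod_mult, Hv. lra. }
assert (Hco : forall n, H (S n) + G (S n) = c).
{ intros n. apply Ceq_minus.
  replace (H (S n) + G (S n) - c) with (1 * (1 * H (S n) + 1 * G (S n)) + - c * 1) by ring.
  (* Since c z / (1 - z) = c / (1 - z) - c, removing c times the geometric series from H + G leaves
     the constant - c, which affects only the coefficient of index 0. *)
  apply (series_sum_const_coeffs n (fun n => 1 * (1 * H n + 1 * G n) + - c * 1) (- c)).
  { repeat apply abel_bounded_linear; auto. apply abel_bounded_geom. }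
  intros z Hz.
  rewrite (series_sum_linear (fun n => 1 * H n + 1 * G n) (fun _ => 1)), series_sum_linear, series_sum_geom;
    auto using abel_bounded_geom, abel_bounded_linear.
  unfold H, G. rewrite !series_sum_rotate by auto.
  pose proof (Cmod_1_minus z Hz) as Hn.
  transitivity (u * (series_sum h (v * z) + v ^ 2 * series_sum k (v * z)) +
    (1 - u * v) * v * series_sum k (v * z) - c / (1 - z)); [cfield; assumption|].
  rewrite E by auto.
  replace (1 - u * (v * z)) with (1 - u * v * z) by ring. rewrite Huv.
  replace (u * (c * (v * z) / (1 - 1 * z))) with (u * v * (c * z / (1 - 1 * z))).
  - rewrite Huv. cfield. assumption.
  - field. now replace (1 - 1 * z) with (1 - z) by ring. }
split; [exact Hco|]. intros z Hz.
assert (EH : series_sum (dcoeffs H) z = series_sum (dcoeffs h) (v * z)).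
{ transitivity (1 * series_sum (dcoeffs h) (v * z)); [|cring].
  rewrite <- series_sum_rotate by auto using abel_bounded_dcoeffs.
  apply series_sum_ext; auto using abel_bounded_dcoeffs. intros n. unfold dcoeffs, H. simpl pow.
  transitivity (u * v * (INR (S n) * h (S n) * v ^ n)); [simpl Complex.Cpow; ring|]. rewrite Huv. ring. }
assert (EG : series_sum (dcoeffs G) z = v ^ 2 * series_sum (dcoeffs k) (v * z)).
{ rewrite <- series_sum_rotate by auto using abel_bounded_dcoeffs.
  apply series_sum_ext; auto using abel_bounded_dcoeffs. intros n. unfold dcoeffs, G. simpl Complex.Cpow. ring. }
apply Re_pos_of_dominated with c; [assumption| |].
- rewrite EH, EG, Cmod_mult, Cmod_pow, Hv, pow1, Rmult_1_l.
  apply sense_preserving_dcoeffs; auto.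
(* By the coefficient identity, (H + G)' is c times the derivative 1 / (1 - z)^2 of the geometric
   series. *)
- transitivity (c * (series_sum (dcoeffs (fun _ => 1 : C)) z * (1 - z) ^ 2));
    [|rewrite series_sum_dcoeffs_geom by assumption; ring].
  rewrite Cmult_assoc. f_equal.
  transitivity (1 * series_sum (dcoeffs H) z + 1 * series_sum (dcoeffs G) z); [ring|].
  transitivity (c * series_sum (dcoeffs (fun _ => 1 : C)) z + 0 * series_sum (dcoeffs (fun _ => 1 : C)) z); [|ring].
  rewrite <- !series_sum_linear by auto using abel_bounded_dcoeffs, abel_bounded_geom.
  apply series_sum_ext; auto using abel_bounded_dcoeffs, abel_bounded_linear.
  intros n. unfold dcoeffs. rewrite <- (Hco n). ring.
Qed.

(** * Rotations, and the convolution of two rotated maps *)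

Lemma Cexpi_plus (s t : R) : Cexpi (s + t) = (Cexpi s : C) * Cexpi t.
Proof.
unfold Cexpi. rewrite cos_plus, sin_plus. apply injective_projections; simpl; ring.
Qed.

Lemma Cexpi_opp_r (t : R) : (Cexpi t : C) * Cexpi (- t) = 1.
Proof.
rewrite <- Cexpi_plus, Rplus_opp_r. unfold Cexpi. now rewrite cos_0, sin_0.
Qed.

Lemma Cmod_Cexpi (t : R) : Cmod (Cexpi t) = 1%R.
Proof.
unfold Cmod, Cexpi. simpl fst; simpl snd. rewrite <- sqrt_1. f_equal.
pose proof (sin2_cos2 t). unfold Rsqr in *. lra.
Qed.

(** Checked on coefficients: 2 (H1 H2 - G1 G2) = (H1 + G1) (H2 - G2) + (H2 + G2) (H1 - G1), where
    both sums are constant from index 1 on; index 0 disappears under differentiation. What results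
    is a positive combination of two quantities with positive real part. *)
Lemma halfplane_product_shear (H1 G1 H2 G2 : nat -> C) (c1 c2 : R) :
  (0 < c1)%R -> (0 < c2)%R ->
  abel_bounded H1 -> abel_bounded G1 -> abel_bounded H2 -> abel_bounded G2 ->
  (forall n, H1 (S n) + G1 (S n) = c1) -> (forall n, H2 (S n) + G2 (S n) = c2) ->
  (forall z, (Cmod z < 1)%R ->
     (0 < Re ((series_sum (dcoeffs H1) z - series_sum (dcoeffs G1) z) * (1 - z) ^ 2)%C)%R) ->
  (forall z, (Cmod z < 1)%R ->
     (0 < Re ((series_sum (dcoeffs H2) z - series_sum (dcoeffs G2) z) * (1 - z) ^ 2)%C)%R) ->
  forall z, (Cmod z < 1)%R ->
  (0 < Re ((series_sum (dcoeffs (fun n => (H1 n * H2 n)%C)) z -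
            series_sum (dcoeffs (fun n => (G1 n * G2 n)%C)) z) * (1 - z) ^ 2)%C)%R.
Proof.
intros Hc1 Hc2 BH1 BG1 BH2 BG2 E1 E2 P1 P2 z Hz.
specialize (P1 z Hz). specialize (P2 z Hz).
set (d1 := series_sum (dcoeffs H1) z - series_sum (dcoeffs G1) z) in P1.
set (d2 := series_sum (dcoeffs H2) z - series_sum (dcoeffs G2) z) in P2.
replace (series_sum (dcoeffs (fun n => H1 n * H2 n)) z - series_sum (dcoeffs (fun n => G1 n * G2 n)) z)
  with ((c1 / 2)%R * d2 + (c2 / 2)%R * d1).
- replace (((c1 / 2)%R * d2 + (c2 / 2)%R * d1) * (1 - z) ^ 2)
    with ((c1 / 2)%R * (d2 * (1 - z) ^ 2) + (c2 / 2)%R * (d1 * (1 - z) ^ 2)) by ring.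
  set (p := d2 * (1 - z) ^ 2) in *. set (q := d1 * (1 - z) ^ 2) in *.
  clearbody p q. pose proof (Rmult_lt_0_compat _ _ Hc1 P2). pose proof (Rmult_lt_0_compat _ _ Hc2 P1).
  unfold Re in *. simpl. lra.
- unfold d1, d2.
  transitivity ((c1 / 2)%R * (1 * series_sum (dcoeffs H2) z + (-1) * series_sum (dcoeffs G2) z) +
    (c2 / 2)%R * (1 * series_sum (dcoeffs H1) z + (-1) * series_sum (dcoeffs G1) z)); [ring|].
  transitivity (1 * series_sum (dcoeffs (fun n => H1 n * H2 n)) z +
    (-1) * series_sum (dcoeffs (fun n => G1 n * G2 n)) z); [|ring].
  rewrite <- !series_sum_linear by auto using abel_bounded_dcoeffs, abel_bounded_mult, abel_bounded_linear.
  apply series_sum_ext; auto using abel_bounded_dcoeffs, abel_bounded_mult, abel_bounded_linear.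
  intros n. unfold dcoeffs. rewrite !RtoC_div by lra. rewrite <- (E1 n), <- (E2 n). field.
Qed.

Lemma Cconj_Cexpi (t : R) : Complex.Cconj (Cexpi t) = Cexpi (- t).
Proof. unfold Cexpi, Complex.Cconj. now rewrite cos_neg, sin_neg. Qed.

(** Conjugation turns the factor [Cexpi (- t)] of the co-analytic part into [Cexpi t], so both parts
    are rotated alike. *)
Lemma harmonic_of_rotate (a b : nat -> C) (t : R) (z : C) :
  abel_bounded a -> abel_bounded b -> (Cmod z < 1)%R ->
  harmonic_of (fun n => Cexpi t * a n * Cexpi (- t) ^ n) (fun n => Cexpi (- t) * b n * Cexpi (- t) ^ n) z =
  Cexpi t * harmonic_of a b (Cexpi (- t) * z).
Proof.
intros Ha Hb Hz. unfold harmonic_of.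
assert (Hz' : (Cmod (Cexpi (- t) * z) < 1)%R) by (rewrite Cmod_mult, Cmod_Cexpi; lra).
rewrite !series_sum_rotate by assumption.
change (Cexpi t * series_sum a (Cexpi (- t) * z) +
    Complex.Cconj (Cexpi (- t) * series_sum b (Cexpi (- t) * z)) =
  Cexpi t * (series_sum a (Cexpi (- t) * z) + Complex.Cconj (series_sum b (Cexpi (- t) * z)))).
rewrite Cmult_conj, Cconj_Cexpi, Ropp_involutive. ring.
Qed.

Lemma Cexpi_mult_cancel (t : R) (z w : C) : Cexpi t * z = Cexpi t * w -> z = w.
Proof.
intros E.
assert (H : forall z : C, Cexpi (- t) * (Cexpi t * z) = z).
{ intros y. transitivity (Cexpi t * Cexpi (- t) * y); [ring|]. rewrite Cexpi_opp_r. ring. }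
rewrite <- (H z), E. apply H.
Qed.

Lemma locally_univalent_rotate (f F : C -> C) (t : R) :
  (forall z, (Cmod z < 1)%R -> F z = Cexpi t * f (Cexpi (- t) * z)) ->
  locally_univalent_on_D f -> locally_univalent_on_D F.
Proof.
intros HF Hloc z Hz.
assert (Hd : forall p q : C, Cmod (Cexpi (- t) * p - Cexpi (- t) * q) = Cmod (p - q)).
{ intros p q. replace (Cexpi (- t) * p - Cexpi (- t) * q) with (Cexpi (- t) * (p - q)) by ring.
  rewrite Cmod_mult, Cmod_Cexpi. ring. }
assert (HD : forall p : C, inD p -> inD (Cexpi (- t) * p)).
{ intros p Hp. change (Cmod (Cexpi (- t) * p) < 1)%R. now rewrite Cmod_mult, Cmod_Cexpi, Rmult_1_l. }
destruct (Hloc (Cexpi (- t) * z) (HD z Hz)) as (r & Hr & H).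
exists r; split; [assumption|]. intros p q Hp Hq Hpz Hqz E.
rewrite !HF in E by assumption.
apply (Cexpi_mult_cancel (- t)), H; auto.
- change (Cmod (Cexpi (- t) * p - Cexpi (- t) * z) < r)%R. rewrite Hd. exact Hpz.
- change (Cmod (Cexpi (- t) * q - Cexpi (- t) * z) < r)%R. rewrite Hd. exact Hqz.
- now apply Cexpi_mult_cancel in E.
Qed.

(** Multiplication by e^{it} carries the line through [w0] of direction -t to the horizontal line
    through e^{it} w0, with the same parameter. *)
Lemma convex_in_direction_rotate (f F : C -> C) (t : R) :
  (forall z, (Cmod z < 1)%R -> F z = Cexpi t * f (Cexpi (- t) * z)) ->
  (forall z1 z2, (Cmod z1 < 1)%R -> (Cmod z2 < 1)%R -> Im (F z1) = Im (F z2) ->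
    (Re (F z1) = Re (F z2) -> z1 = z2) /\
    (forall s, (Rmin (Re (F z1)) (Re (F z2)) <= s <= Rmax (Re (F z1)) (Re (F z2)))%R ->
       exists z, (Cmod z < 1)%R /\ F z = (s, Im (F z1)))) ->
  convex_in_direction f (- t).
Proof.
intros HF HS.
assert (HD : forall s (p : C), (Cmod p < 1)%R -> (Cmod (Cexpi s * p) < 1)%R).
{ intros s p Hp. now rewrite Cmod_mult, Cmod_Cexpi, Rmult_1_l. }
assert (Hf : forall z, (Cmod z < 1)%R -> F (Cexpi t * z) = Cexpi t * f z).
{ intros z Hz. rewrite HF by auto. f_equal. f_equal.
  transitivity (Cexpi t * Cexpi (- t) * z); [ring|]. rewrite Cexpi_opp_r. ring. }
split.
- intros z w Hz Hw E. apply (Cexpi_mult_cancel t).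
  assert (E' : F (Cexpi t * z) = F (Cexpi t * w)) by (rewrite !Hf, E by assumption; reflexivity).
  apply (HS (Cexpi t * z) (Cexpi t * w)); auto; now rewrite E'.
- intros w0 s1 s2 s Hs1 Hs2 (z1 & Hz1 & W1) (z2 & Hz2 & W2).
  set (a := Cexpi t * w0).
  assert (HW : forall r : R, Cexpi t * (Cadd w0 (Cmul (RtoC r) (Cexpi (- t)))) = a + r).
  { intros r. transitivity (a + Cexpi t * Cexpi (- t) * r).
    - change (Cexpi t * (w0 + r * Cexpi (- t)) = a + Cexpi t * Cexpi (- t) * r). unfold a. ring.
    - rewrite Cexpi_opp_r. ring. }
  assert (X1 : F (Cexpi t * z1) = a + s1) by (rewrite Hf, W1 by assumption; apply HW).
  assert (X2 : F (Cexpi t * z2) = a + s2) by (rewrite Hf, W2 by assumption; apply HW).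
  destruct (HS (Cexpi t * z1) (Cexpi t * z2)) as [_ HS2]; auto.
  { rewrite X1, X2. unfold Im. simpl. ring. }
  destruct (HS2 (Re a + s)%R) as (z & Hz & Ez).
  { rewrite X1, X2. change (Re (a + s1)%C) with (Re a + s1)%R.
    change (Re (a + s2)%C) with (Re a + s2)%R.
    rewrite Rmin_left, Rmax_right by lra. lra. }
  exists (Cexpi (- t) * z). split; [now apply HD|].
  apply (Cexpi_mult_cancel t). rewrite <- HF by assumption. rewrite Ez, HW, X1.
  apply injective_projections; simpl; unfold Re, Im; simpl; ring.
Qed.

Lemma Cmod_1_plus_pos (a : C) : (Cmod a < 1)%R -> (0 < 1 + aprime a)%R.
Proof.
intros Ha. unfold aprime. change (Cnorm (Cadd Cone a)) with (Cmod (1 + a)).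
assert (0 < Cmod (1 + a))%R; [|lra].
replace (1 + a) with (1 - - a) by ring. apply Cmod_gt_0, Cmod_1_minus. now rewrite Cmod_opp.
Qed.

(** Rotation factors multiply coefficientwise, so convolving the maps rotated by t1 and t2 gives the
    convolution rotated by t1 + t2. The horizontal direction of the shear thus becomes -(t1 +
    t2). *)
Lemma halfplane_convolution_convex (h1 k1 h2 k2 : nat -> C) (c1 c2 t1 t2 : R) :
  (0 < c1)%R -> (0 < c2)%R ->
  abel_bounded h1 -> abel_bounded k1 -> abel_bounded h2 -> abel_bounded k2 ->
  sense_preserving h1 k1 -> sense_preserving h2 k2 ->
  (forall z, (Cmod z < 1)%R ->
     series_sum h1 z + Cexpi (-2 * t1) * series_sum k1 z = c1 * z / (1 - Cexpi t1 * z)) ->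
  (forall z, (Cmod z < 1)%R ->
     series_sum h2 z + Cexpi (-2 * t2) * series_sum k2 z = c2 * z / (1 - Cexpi t2 * z)) ->
  locally_univalent_on_D (harm_conv h1 k1 h2 k2) ->
  convex_in_direction (harm_conv h1 k1 h2 k2) (- (t1 + t2)).
Proof.
intros C1 C2 Bh1 Bk1 Bh2 Bk2 S1 S2 F1 F2 Hloc.
assert (Hsq : forall t, Cexpi (-2 * t) = (Cexpi (- t) : C) ^ 2).
{ intros t. replace (-2 * t)%R with (- t + - t)%R by ring. rewrite Cexpi_plus. cring. }
destruct (halfplane_map_rotated h1 k1 c1 (Cexpi t1) (Cexpi (- t1))) as [E1 P1];
  auto using Cexpi_opp_r, Cmod_Cexpi.
{ intros z Hz. rewrite <- Hsq. now apply F1. }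
destruct (halfplane_map_rotated h2 k2 c2 (Cexpi t2) (Cexpi (- t2))) as [E2 P2];
  auto using Cexpi_opp_r, Cmod_Cexpi.
{ intros z Hz. rewrite <- Hsq. now apply F2. }
pose proof (abel_bounded_rotate h1 (Cexpi t1) (Cexpi (- t1)) Bh1 (Cmod_Cexpi _)) as BH1.
pose proof (abel_bounded_rotate k1 (Cexpi (- t1)) (Cexpi (- t1)) Bk1 (Cmod_Cexpi _)) as BG1.
pose proof (abel_bounded_rotate h2 (Cexpi t2) (Cexpi (- t2)) Bh2 (Cmod_Cexpi _)) as BH2.
pose proof (abel_bounded_rotate k2 (Cexpi (- t2)) (Cexpi (- t2)) Bk2 (Cmod_Cexpi _)) as BG2.
pose proof (halfplane_product_shear _ _ _ _ _ _ C1 C2 BH1 BG1 BH2 BG2 E1 E2 P1 P2) as P.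
pose proof (abel_bounded_mult _ _ BH1 BH2) as BA. pose proof (abel_bounded_mult _ _ BG1 BG2) as BB.
cbv beta in P, BA, BB.
set (A := fun n => Cexpi t1 * h1 n * Cexpi (- t1) ^ n * (Cexpi t2 * h2 n * Cexpi (- t2) ^ n)) in *.
set (B := fun n => Cexpi (- t1) * k1 n * Cexpi (- t1) ^ n * (Cexpi (- t2) * k2 n * Cexpi (- t2) ^ n)) in *.
assert (EA : forall n, A n = Cexpi (t1 + t2) * (h1 n * h2 n) * Cexpi (- (t1 + t2)) ^ n).
{ intros n. unfold A. rewrite Ropp_plus_distr, !Cexpi_plus, Cpow_mult_l. ring. }
assert (EB : forall n, B n = Cexpi (- (t1 + t2)) * (k1 n * k2 n) * Cexpi (- (t1 + t2)) ^ n).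
{ intros n. unfold B. rewrite Ropp_plus_distr, !Cexpi_plus, Cpow_mult_l. ring. }
assert (HF : forall z, (Cmod z < 1)%R -> harmonic_of A B z =
  Cexpi (t1 + t2) * harm_conv h1 k1 h2 k2 (Cexpi (- (t1 + t2)) * z)).
{ intros z Hz. unfold harm_conv.
  etransitivity; [|apply (harmonic_of_rotate (fun n => h1 n * h2 n) (fun n => k1 n * k2 n));
    auto using abel_bounded_mult].
  unfold harmonic_of. f_equal; [|f_equal]; apply series_sum_ext; auto. }
apply (convex_in_direction_rotate _ (harmonic_of A B)); [exact HF|].
apply disc_shear; [assumption|assumption|assumption|].
now apply (locally_univalent_rotate (harm_conv h1 k1 h2 k2) _ (t1 + t2)).
Qed.

Open Scope R_scope.

Theorem theorem2 (a1 a2 : Cplx) (g1 g2 : R) (h1 k1 h2 k2 : nat -> Cplx) :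
  inD a1 -> inD a2 ->
  0 <= g1 < 2 * PI -> 0 <= g2 < 2 * PI ->
  in_S_halfplane a1 g1 h1 k1 ->
  in_S_halfplane a2 g2 h2 k2 ->
  (forall z, inD z ->
     Cadd (series_sum h1 z) (Cmul (Cexpi (-2 * (g1 + gamma_a a1))) (series_sum k1 z))
     = Cdiv (Cmul (RtoC (1 + aprime a1)) z)
            (Csub Cone (Cmul (Cexpi (g1 + gamma_a a1)) z))) ->
  (forall z, inD z ->
     Cadd (series_sum h2 z) (Cmul (Cexpi (-2 * (g2 + gamma_a a2))) (series_sum k2 z))
     = Cdiv (Cmul (RtoC (1 + aprime a2)) z)
            (Csub Cone (Cmul (Cexpi (g2 + gamma_a a2)) z))) ->
  locally_univalent_on_D (harm_conv h1 k1 h2 k2) ->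
  univalent_on_D (harm_conv h1 k1 h2 k2) /\
  convex_in_direction (harm_conv h1 k1 h2 k2)
    (- (g1 + g2 + gamma_a a1 + gamma_a a2)).
Proof.
intros Ha1 Ha2 _ _ [(Bh1 & Bk1 & _ & _ & _ & S1 & _) _] [(Bh2 & Bk2 & _ & _ & _ & S2 & _) _] F1 F2 Hloc.
assert (H : convex_in_direction (harm_conv h1 k1 h2 k2) (- ((g1 + gamma_a a1) + (g2 + gamma_a a2)))).
{ apply (halfplane_convolution_convex h1 k1 h2 k2 (1 + aprime a1) (1 + aprime a2));
    auto using analytic_abel_bounded, Cmod_1_plus_pos. }
replace (g1 + g2 + gamma_a a1 + gamma_a a2) with ((g1 + gamma_a a1) + (g2 + gamma_a a2)) by ring.
split; [apply H|exact H].
Qed.
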